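(* When the number of voters $m$ is a constant, the constructive control variant of Real Value Perception Manipulation (RVPM) can be solved in polynomial time under the $l_\infty$ norm for arbitrary scoring rules.
   Context: Spatial election model: $n$ candidates $c_1,\dots,c_n$ and $m$ voters $v_1,\dots,v_m$ are points of $\mathbb R^d$. Each voter ranks candidates by increasing $l_\infty$ distance; closest ranked 1; original rankings have no ties. A scoring rule is a non-increasing $f:\{1,\dots,n\}\to\mathbb R$: a candidate ranked $t$ by a voter receives $f(t)$; totals summed; highest total wins. Given $\epsilon>0$, an adversary may replace target $c_1$ by any $\tilde c_1\in\mathbb R^d$ with $\|\tilde c_1-c_1\|_\infty\le\epsilon$; ties created by the manipulation are broken in the adversary's favor. Constructive control: decide whether some such $\tilde c_1$ makes $c_1$ win (with $c_1$ placed ahead of equidistant candidates, its total is at least every other candidate's total). *)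

(* Defs.v *)
From Stdlib Require Import Reals Lra Lia List Arith.
Import ListNotations.
Open Scope R_scope.

(* Points of R^d are functions nat -> R; only coordinates 0..d-1 count. *)
(* Candidates are indexed 0..n-1; index 0 is the target c_1.           *)
(* Voters are indexed 0..m-1.  f t is the score of rank t (1..n).      *)

Definition point := nat -> R.

Definition linf_dist (d : nat) (p q : point) : R :=
  fold_right Rmax 0 (map (fun i => Rabs (p i - q i)) (seq 0 d)).

Definition moved (C : nat -> point) (ct : point) (j : nat) : point :=
  if Nat.eqb j 0 then ct else C j.

(* Voter at v ranks candidate k strictly ahead of candidate j, in the
   manipulated instance: k is closer, or equidistant and k is c_1
   (ties created by the manipulation are broken in favour of c_1). *)
Definition aheadb (d : nat) (P : nat -> point) (v : point) (k j : nat) : bool :=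
  if Rlt_dec (linf_dist d v (P k)) (linf_dist d v (P j)) then true
  else if Req_EM_T (linf_dist d v (P k)) (linf_dist d v (P j))
       then Nat.eqb k 0 else false.

Definition rank (n d : nat) (P : nat -> point) (v : point) (j : nat) : nat :=
  S (length (filter (fun k => andb (negb (Nat.eqb k j)) (aheadb d P v k j)) (seq 0 n))).

Definition score (n m d : nat) (f : nat -> R) (P : nat -> point)
    (V : nat -> point) (j : nat) : R :=
  fold_right Rplus 0 (map (fun i => f (rank n d P (V i) j)) (seq 0 m)).

Definition c1_wins (n m d : nat) (f : nat -> R) (P : nat -> point)
    (V : nat -> point) : Prop :=
  forall j, (j < n)%nat -> score n m d f P V j <= score n m d f P V 0.

Definition constructive_control (n m d : nat) (eps : R) (f : nat -> R)
    (C V : nat -> point) : Prop :=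
  exists ct : point,
    (forall i, (i < d)%nat -> Rabs (ct i - C 0%nat i) <= eps) /\
    c1_wins n m d f (moved C ct) V.

Definition valid_instance (n m d : nat) (eps : R) (f : nat -> R)
    (C V : nat -> point) : Prop :=
  (1 <= n)%nat /\ 0 < eps /\
  (forall s t, (1 <= s)%nat -> (s <= t)%nat -> (t <= n)%nat -> f t <= f s) /\
  (forall i j k, (i < m)%nat -> (j < n)%nat -> (k < n)%nat -> j <> k ->
     linf_dist d (V i) (C j) <> linf_dist d (V i) (C k)).

(* 2. Model of computation: constant-free real-RAM (BSS machine with   *)
(*    integer index registers and indirect addressing), unit cost.     *)

Inductive instr : Type :=
| RFromNat (i a : nat)
| RAdd (i j k : nat)
| RSub (i j k : nat)
| RMul (i j k : nat)
| RDiv (i j k : nat)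
| RLoad (i a : nat)
| RStore (i a : nat)
| NZero (a : nat)
| NInc (a : nat)
| NDec (a : nat)
| NCopy (a b : nat)
| JmpNZero (a l : nat)
| JmpRPos (i l : nat)
| Jmp (l : nat).

Definition program := list instr.

Record mstate := MState { pc : nat; nreg : nat -> nat; rreg : nat -> R }.

Definition updN (N : nat -> nat) (a v : nat) : nat -> nat :=
  fun x => if Nat.eqb x a then v else N x.
Definition updR (X : nat -> R) (a : nat) (v : R) : nat -> R :=
  fun x => if Nat.eqb x a then v else X x.

Definition halted (p : program) (s : mstate) : Prop := (length p <= pc s)%nat.

Definition step (p : program) (s : mstate) : mstate :=
  let '(MState q N X) := s in
  match nth_error p q with
  | None => s
  | Some ins =>
    match ins with
    | RFromNat i a => MState (S q) N (updR X i (INR (N a)))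
    | RAdd i j k => MState (S q) N (updR X i (X j + X k))
    | RSub i j k => MState (S q) N (updR X i (X j - X k))
    | RMul i j k => MState (S q) N (updR X i (X j * X k))
    | RDiv i j k => MState (S q) N
        (updR X i (if Req_EM_T (X k) 0 then 0 else X j / X k))
    | RLoad i a => MState (S q) N (updR X i (X (N a)))
    | RStore i a => MState (S q) N (updR X (N a) (X i))
    | NZero a => MState (S q) (updN N a 0) X
    | NInc a => MState (S q) (updN N a (S (N a))) X
    | NDec a => MState (S q) (updN N a (pred (N a))) X
    | NCopy a b => MState (S q) (updN N a (N b)) X
    | JmpNZero a l => MState (if Nat.eqb (N a) 0 then l else S q) N X
    | JmpRPos i l => MState (if Rlt_dec 0 (X i) then l else S q) N X
    | Jmp l => MState l N X
    end
  end.

Fixpoint run (p : program) (t : nat) (s : mstate) : mstate :=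
  match t with
  | O => s
  | S t' => run p t' (step p s)
  end.

Definition init_state (n m d : nat) (inp : list R) : mstate :=
  MState 0 (fun a => match a with 0 => n | 1 => m | 2 => d | _ => 0 end)%nat
         (fun i => nth i inp 0).

Definition accepts (s : mstate) : bool := negb (Nat.eqb (nreg s 0) 0).

Definition decides_within (p : program) (n m d : nat) (inp : list R)
    (b : bool) (T : nat) : Prop :=
  exists t, (t <= T)%nat /\
    halted p (run p t (init_state n m d inp)) /\
    accepts (run p t (init_state n m d inp)) = b.

Definition encode (n m d : nat) (eps : R) (f : nat -> R) (C V : nat -> point)
    : list R :=
  eps :: map f (seq 1 n)
      ++ flat_map (fun j => map (C j) (seq 0 d)) (seq 0 n)
      ++ flat_map (fun i => map (V i) (seq 0 d)) (seq 0 m).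

(* Input size: number of reals plus the three integer parameters. *)
Definition input_size (n m d : nat) : nat :=
  (1 + n + (n + m) * d + n + m + d)%nat.

(* Main.v *)
Require Import Defs.
From Stdlib Require Import Reals Lra Lia List Arith.
Import ListNotations.
Open Scope R_scope.

(* A voter's ballot depends on the target only through the set of candidates
   strictly closer to that voter, and coming closer to every voter never hurts
   the target.  So it suffices to guess, for each of the m voters, one of n upper
   bounds on the distance to the target: the distance to another candidate, or no
   bound.  For a given guess, the admissible positions form an intersection of
   boxes, tested coordinate by coordinate, and the scores can be computed as if
   the bounds were attained.  There are n^m guesses.

   The search is an expression of a small language with bounded sums, bounded
   folds and tests, in parametric higher-order abstract syntax: instantiating the
   variables with values gives its meaning, instantiating them with register
   numbers gives its code. *)

(** * Structured commands for the real RAM *)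

(** Why distances to candidates suffice: for a position that works, bound each voter by the distance
    to the nearest other candidate at least as far as the target. No candidate lies strictly in
    between, so pushing the target out to the bound, where the tie goes to it, keeps the ballot. The
    resulting table of distances need not come from any point, so ranks are studied on arbitrary
    tables.

    On the machine side, [m] is a Rocq number: the search is unrolled into [m] nested loops, so the
    program and the exponent depend on [m]. Loop counts are computed at run time, so values must be
    bounded together with running time. The input occupies the real registers from 0 on, where
    compiled code wants scratch space; it is moved away first. *)

Definition store := ((nat -> nat) * (nat -> R))%type.

Inductive cmd : Type :=
| Op (ins : instr)
| Seq (c1 c2 : cmd)
| IfPos (r : nat) (c1 c2 : cmd)
| Loop (a : nat) (c : cmd).

Infix ";;" := Seq (at level 90, right associativity).

Definition is_jump (ins : instr) : bool :=
  match ins with JmpNZero _ _ | JmpRPos _ _ | Jmp _ => true | _ => false end.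

(** Running [step] on a one-instruction program reuses the machine semantics instead of restating
    it. *)
Definition act (ins : instr) (s : store) : store :=
  let s' := step [ins] (MState 0 (fst s) (snd s)) in (nreg s', rreg s').

(** Big-step semantics counting the exact machine steps of the assembled code: the last 1 in
    [ex_if_npos] is the jump over the other branch, and each loop round pays for a test, a decrement
    and a jump back. *)
Inductive ex : cmd -> store -> nat -> store -> Prop :=
| ex_op ins s : is_jump ins = false -> ex (Op ins) s 1 (act ins s)
| ex_seq c1 c2 s t1 s1 t2 s2 :
    ex c1 s t1 s1 -> ex c2 s1 t2 s2 -> ex (c1 ;; c2) s (t1 + t2) s2
| ex_if_pos r c1 c2 s t s' :
    0 < snd s r -> ex c1 s t s' -> ex (IfPos r c1 c2) s (1 + t) s'
| ex_if_npos r c1 c2 s t s' :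
    ~ 0 < snd s r -> ex c2 s t s' -> ex (IfPos r c1 c2) s (1 + t + 1) s'
| ex_loop_zero a c s : fst s a = 0%nat -> ex (Loop a c) s 1 s
| ex_loop_step a c s t s1 t' s2 :
    fst s a <> 0%nat -> ex c (act (NDec a) s) t s1 -> ex (Loop a c) s1 t' s2 ->
    ex (Loop a c) s (2 + t + 1 + t') s2.

(** Jump targets are absolute, hence [off]. [JmpRPos] falls through when its test fails, so the else
    branch comes first. [JmpNZero] jumps when its register is zero, so it is the loop exit. *)
Fixpoint assemble (off : nat) (c : cmd) : program :=
  match c with
  | Op ins => [ins]
  | Seq c1 c2 =>
      let p1 := assemble off c1 in p1 ++ assemble (off + length p1) c2
  | IfPos r c1 c2 =>
      let p2 := assemble (1 + off) c2 in
      let l := (2 + off + length p2)%nat in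
      let p1 := assemble l c1 in
      JmpRPos r l :: p2 ++ Jmp (l + length p1) :: p1
  | Loop a c =>
      let p := assemble (2 + off) c in
      JmpNZero a (3 + off + length p) :: NDec a :: p ++ [Jmp off]
  end.

Fixpoint code_at (p : program) (off : nat) (c : program) : Prop :=
  match c with
  | [] => True
  | ins :: c' => nth_error p off = Some ins /\ code_at p (S off) c'
  end.

Lemma code_at_app p c1 c2 off :
  code_at p off (c1 ++ c2) -> code_at p off c1 /\ code_at p (off + length c1) c2.
Proof.
  revert off; induction c1 as [|i c1 IH]; intros off; simpl.
  - now rewrite Nat.add_0_r.
  - intros [H1 H2]. apply IH in H2. rewrite <- Nat.add_succ_comm. tauto.
Qed.

Lemma code_at_self c p : code_at (p ++ c) (length p) c.
Proof.
  revert p; induction c as [|i c IH]; intros p; simpl; [exact I|split].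
  - rewrite nth_error_app2, Nat.sub_diag by lia. reflexivity.
  - specialize (IH (p ++ [i])). rewrite <- app_assoc, length_app in IH.
    simpl in IH. now rewrite Nat.add_1_r in IH.
Qed.

Lemma run_add p t1 t2 s : run p (t1 + t2) s = run p t2 (run p t1 s).
Proof. revert s; induction t1 as [|t1 IH]; intros s; simpl; auto. Qed.

Lemma step_act p q ins s :
  nth_error p q = Some ins -> is_jump ins = false ->
  step p (MState q (fst s) (snd s)) =
  MState (S q) (fst (act ins s)) (snd (act ins s)).
Proof.
  intros H J. unfold step. rewrite H. destruct ins; try discriminate; reflexivity.
Qed.

Lemma assemble_correct c s t s' :
  ex c s t s' -> forall off p, code_at p off (assemble off c) ->
  run p t (MState off (fst s) (snd s)) =
  MState (off + length (assemble off c)) (fst s') (snd s').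
Proof.
  induction 1 as [ins s J|c1 c2 s t1 s1 t2 s2 _ IH1 _ IH2
    |r c1 c2 s t s' Hr _ IH|r c1 c2 s t s' Hr _ IH
    |a c s Ha|a c s t s1 t' s2 Ha _ IH1 _ IH2]; intros off p; cbn [assemble].
  - intros [H _]. cbn [run]. rewrite (step_act _ _ _ _ H J).
    f_equal. simpl; lia.
  - intros H. apply code_at_app in H as [H1 H2].
    rewrite run_add, (IH1 _ _ H1), (IH2 _ _ H2), length_app.
    f_equal; lia.
  - intros [H1 H2]. apply code_at_app in H2 as [_ [_ H2]].
    replace (S (S off + length (assemble (1 + off) c2)))
      with (2 + off + length (assemble (1 + off) c2))%nat in H2 by lia.
    cbn [run plus]. unfold step at 1. rewrite H1.
    destruct (Rlt_dec 0 (snd s r)); [|contradiction].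
    rewrite (IH _ _ H2). f_equal. cbn [length plus].
    rewrite length_app; cbn [length plus]; lia.
  - intros [H1 H2]. apply code_at_app in H2 as [H2 [H3 _]].
    rewrite run_add. cbn [run plus]. unfold step at 2. rewrite H1.
    destruct (Rlt_dec 0 (snd s r)); [contradiction|].
    rewrite (IH _ _ H2).
    unfold step. cbn [plus] in H3 |- *. rewrite H3.
    f_equal. cbn [length plus].
    rewrite length_app; cbn [length plus]; lia.
  - intros [H1 _]. cbn [run]. unfold step. rewrite H1.
    rewrite (proj2 (Nat.eqb_eq _ _) Ha).
    f_equal. cbn [length plus]. rewrite length_app; cbn [length plus]; lia.
  - intros H. pose proof H as H0. cbn [code_at] in H. destruct H as [H1 [H2 H3]].
    apply code_at_app in H3 as [H3 [H4 _]].
    rewrite !run_add. cbn [run plus]. unfold step at 3. rewrite H1.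
    rewrite (proj2 (Nat.eqb_neq _ _) Ha).
    rewrite (step_act _ _ _ _ H2 eq_refl).
    rewrite (IH1 _ _ H3).
    unfold step at 1. cbn [plus] in H4 |- *. rewrite H4.
    exact (IH2 _ _ H0).
Qed.

(** * Total-correctness triples with a time budget *)

Definition does (c : cmd) (s : store) (B : nat) (Q : store -> Prop) : Prop :=
  exists t s', (t <= B)%nat /\ ex c s t s' /\ Q s'.

Lemma does_weaken c s B B' (Q Q' : store -> Prop) :
  does c s B Q -> (B <= B')%nat -> (forall s', Q s' -> Q' s') -> does c s B' Q'.
Proof. intros (t & s' & Ht & He & Hq) HB HQ. exists t, s'. repeat split; auto; lia. Qed.

Lemma does_le c s B B' Q : does c s B Q -> (B <= B')%nat -> does c s B' Q.
Proof. intros H HB. exact (does_weaken _ _ _ _ _ _ H HB (fun _ HQ => HQ)). Qed.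

Lemma does_op ins s (Q : store -> Prop) :
  is_jump ins = false -> Q (act ins s) -> does (Op ins) s 1 Q.
Proof. intros J H. exists 1%nat, (act ins s). repeat split; auto. now constructor. Qed.

Lemma does_seq c1 c2 s B1 B2 B Q1 Q :
  does c1 s B1 Q1 -> (forall s', Q1 s' -> does c2 s' B2 Q) -> (B1 + B2 <= B)%nat ->
  does (c1 ;; c2) s B Q.
Proof.
  intros (t1 & s1 & Ht1 & E1 & HQ1) H2 HB.
  destruct (H2 s1 HQ1) as (t2 & s2 & Ht2 & E2 & HQ).
  exists (t1 + t2)%nat, s2. repeat split; auto; [lia|]. econstructor; eauto.
Qed.

Lemma does_op_seq ins c s B (Q : store -> Prop) :
  is_jump ins = false -> does c (act ins s) B Q -> does (Op ins ;; c) s (1 + B) Q.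
Proof.
  intros J H. eapply does_seq.
  - apply (does_op ins s (fun s' => s' = act ins s) J eq_refl).
  - intros s' ->. exact H.
  - lia.
Qed.

Lemma does_if r c1 c2 s B Q :
  (0 < snd s r -> does c1 s B Q) -> (~ 0 < snd s r -> does c2 s B Q) ->
  does (IfPos r c1 c2) s (2 + B) Q.
Proof.
  intros H1 H2. destruct (Rlt_dec 0 (snd s r)) as [H|H].
  - destruct (H1 H) as (t & s' & Ht & E & HQ).
    exists (1 + t)%nat, s'. repeat split; auto; [lia|]. now apply ex_if_pos.
  - destruct (H2 H) as (t & s' & Ht & E & HQ).
    exists (1 + t + 1)%nat, s'. repeat split; auto; [lia|]. now apply ex_if_npos.
Qed.

(* The invariant [I j] holds when [j] iterations remain. *)
Lemma does_loop (I : nat -> store -> Prop) a c s B (Q : store -> Prop) :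
  I (fst s a) s ->
  (forall j s1, fst s1 a = S j -> I (S j) s1 ->
     does c (act (NDec a) s1) B (fun s2 => fst s2 a = j /\ I j s2)) ->
  (forall s1, fst s1 a = 0%nat -> I 0%nat s1 -> Q s1) ->
  does (Loop a c) s (1 + fst s a * (B + 3)) Q.
Proof.
  intros HI Hstep Hend. remember (fst s a) as j eqn:Hj. symmetry in Hj.
  revert s Hj HI; induction j as [|j IH]; intros s Hj HI.
  - exists 1%nat, s. repeat split; auto. now constructor.
  - destruct (Hstep j s Hj HI) as (t & s1 & Ht & E & Hj1 & HI1).
    destruct (IH s1 Hj1 HI1) as (t' & s2 & Ht' & E' & HQ).
    exists (2 + t + 1 + t')%nat, s2. repeat split; auto.
    + simpl; lia.
    + econstructor; eauto. lia.
Qed.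

Ltac upd := cbn [act step fst snd nth_error nreg rreg] in *; unfold updN, updR in *;
  repeat match goal with
  | |- context [Nat.eqb ?x ?y] => destruct (Nat.eqb_spec x y); try lia
  | H : context [Nat.eqb ?x ?y] |- _ => destruct (Nat.eqb_spec x y); try lia
  end; try reflexivity.

(** The machine has no integer addition: [b] is drained into [a] unit by unit. A sum thus costs time
    linear in the value added, one reason for bounding values below. *)
Lemma does_add_into a b s : a <> b ->
  does (Loop b (Op (NInc a))) s (1 + 4 * fst s b)
    (fun s' => fst s' a = (fst s a + fst s b)%nat /\
       (forall x, x <> a -> x <> b -> fst s' x = fst s x) /\
       (forall x, snd s' x = snd s x)).
Proof.
  intros Hab.
  eapply does_weaken; [apply (does_loop (fun j s' => (fst s' a + j = fst s a + fst s b)%nat /\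
       (forall x, x <> a -> x <> b -> fst s' x = fst s x) /\
       (forall x, snd s' x = snd s x)) b _ s 1)| |].
  - auto.
  - intros j s1 Hj (H1 & H2 & H3). apply does_op; [reflexivity|].
    repeat split.
    + upd.
    + upd.
    + intros x Hx1 Hx2. rewrite <- (H2 x) by auto. upd.
    + intros x. rewrite <- (H3 x). upd.
  - intros s1 _ H. exact H.
  - lia.
  - simpl. intros s' (H1 & H2 & H3). repeat split; auto. lia.
Qed.

Fixpoint set_lit (a c : nat) : cmd :=
  match c with
  | O => Op (NZero a)
  | S c' => set_lit a c' ;; Op (NInc a)
  end.

Lemma does_set_lit a c s :
  does (set_lit a c) s (1 + c)
    (fun s' => fst s' a = c /\ (forall x, x <> a -> fst s' x = fst s x) /\
       (forall x, snd s' x = snd s x)).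
Proof.
  induction c as [|c IH]; cbn [set_lit].
  - apply does_op; [reflexivity|]. repeat split; intros; upd.
  - eapply does_seq; [exact IH| |rewrite Nat.add_comm; apply le_n].
    intros s' (H1 & H2 & H3). apply does_op; [reflexivity|].
    repeat split.
    + upd.
    + intros x Hx. rewrite <- H2 by auto. upd.
    + intros x. rewrite <- H3. upd.
Qed.

(** * Expressions and their compilation *)

Inductive ty := TN | TR.

Definition val (t : ty) : Type := match t with TN => nat | TR => R end.

Inductive exp (VN VR : Type) : ty -> Type :=
| ENVar (x : VN) : exp VN VR TN
| ERVar (x : VR) : exp VN VR TR
| ELit (c : nat) : exp VN VR TN
| EAdd (e1 e2 : exp VN VR TN) : exp VN VR TN
| ESum (b : exp VN VR TN) (f : VN -> exp VN VR TN) : exp VN VR TN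
| EIf (t : ty) (c : exp VN VR TR) (e1 e2 : exp VN VR t) : exp VN VR t
| EInp (e : exp VN VR TN) : exp VN VR TR
| ENat (e : exp VN VR TN) : exp VN VR TR
| ESub (e1 e2 : exp VN VR TR) : exp VN VR TR
| EFold (b : exp VN VR TN) (x : exp VN VR TR) (f : VN -> VR -> exp VN VR TR)
    : exp VN VR TR.

Arguments ENVar {VN VR} x.
Arguments ERVar {VN VR} x.
Arguments ELit {VN VR} c.
Arguments EAdd {VN VR} e1 e2.
Arguments ESum {VN VR} b f.
Arguments EIf {VN VR t} c e1 e2.
Arguments EInp {VN VR} e.
Arguments ENat {VN VR} e.
Arguments ESub {VN VR} e1 e2.
Arguments EFold {VN VR} b x f.

Fixpoint iterR (n : nat) (g : nat -> R -> R) (x : R) : R :=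
  match n with O => x | S k => g k (iterR k g x) end.

Fixpoint nsum (n : nat) (g : nat -> nat) : nat :=
  match n with O => 0 | S k => nsum k g + g k end.

Fixpoint eval (inp : nat -> R) {t} (e : exp nat R t) : val t :=
  match e in exp _ _ t return val t with
  | ENVar x => x
  | ERVar x => x
  | ELit c => c
  | EAdd e1 e2 => (eval inp e1 + eval inp e2)%nat
  | ESum b f => nsum (eval inp b) (fun k => eval inp (f k))
  | EIf c e1 e2 => if Rlt_dec 0 (eval inp c) then eval inp e1 else eval inp e2
  | EInp e => inp (eval inp e)
  | ENat e => INR (eval inp e)
  | ESub e1 e2 => eval inp e1 - eval inp e2
  | EFold b x f => iterR (eval inp b) (fun k y => eval inp (f k y)) (eval inp x)
  end.

(* The value of [e] is left in integer register [a] or real register [i];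
   registers below [a] and [i] are not written.  Integer register 3 holds the
   address of the input. *)
Fixpoint code {t} (e : exp nat nat t) (a i : nat) : cmd :=
  match e with
  | ENVar r => Op (NCopy a r)
  | ERVar r => Op (RSub (1 + i) (1 + i) (1 + i)) ;; Op (RAdd i r (1 + i))
  | ELit c => set_lit a c
  | EAdd e1 e2 => code e1 a i ;; code e2 (1 + a) i ;; Loop (1 + a) (Op (NInc a))
  | ESum b f =>
      code b a i ;; Op (NCopy (1 + a) a) ;; Op (NZero a) ;; Op (NZero (2 + a)) ;;
      Loop (1 + a)
        (code (f (2 + a)%nat) (3 + a) i ;; Loop (3 + a) (Op (NInc a)) ;;
         Op (NInc (2 + a)))
  | EIf c e1 e2 => code c a i ;; IfPos i (code e1 a i) (code e2 a i)
  | EInp e =>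
      code e a i ;; Op (NCopy (1 + a) 3) ;; Loop (1 + a) (Op (NInc a)) ;;
      Op (RLoad i a)
  | ENat e => code e a i ;; Op (RFromNat i a)
  | ESub e1 e2 => code e1 a i ;; code e2 a (1 + i) ;; Op (RSub i i (1 + i))
  | EFold b x f =>
      code b a i ;; Op (NZero (1 + a)) ;; code x (2 + a) i ;;
      Loop a
        (code (f (1 + a)%nat i) (2 + a) (1 + i) ;;
         Op (RSub (2 + i) (2 + i) (2 + i)) ;; Op (RAdd i (1 + i) (2 + i)) ;;
         Op (NInc (1 + a)))
  end.

(* Real registers from [top e a i] on are not written. *)
Fixpoint top {t} (e : exp nat nat t) (a i : nat) : nat :=
  match e with
  | ENVar _ | ELit _ => 0
  | ERVar _ => 2 + i
  | EAdd e1 e2 => max (top e1 a i) (top e2 (1 + a) i)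
  | ESum b f => max (top b a i) (top (f (2 + a)%nat) (3 + a) i)
  | EIf c e1 e2 => max (top c a i) (max (top e1 a i) (top e2 a i))
  | EInp e | ENat e => max (1 + i) (top e a i)
  | ESub e1 e2 => max (2 + i) (max (top e1 a i) (top e2 a (1 + i)))
  | EFold b x f =>
      max (3 + i) (max (top b a i)
        (max (top x (2 + a) i) (top (f (1 + a)%nat i) (2 + a) (1 + i))))
  end.

(* Bounds both the running time and, for integer expressions, the value, when
   the free integer variables and the input address are at most [S]. *)
Fixpoint bnd {t} (e : exp nat nat t) (a i : nat) (S : nat) : nat :=
  match e with
  | ENVar _ => 1 + S
  | ERVar _ => 2
  | ELit c => 1 + c
  | EAdd e1 e2 => bnd e1 a i S + 5 * bnd e2 (1 + a) i S + 1
  | ESum b f =>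
      let B := bnd b a i S in
      B + 4 + B * (5 * bnd (f (2 + a)%nat) (3 + a) i (S + B) + 5)
  | EIf c e1 e2 => bnd c a i S + bnd e1 a i S + bnd e2 a i S + 2
  | EInp e => bnd e a i S + 4 * S + 3
  | ENat e => bnd e a i S + 1
  | ESub e1 e2 => bnd e1 a i S + bnd e2 a (1 + i) S + 1
  | EFold b x f =>
      let B := bnd b a i S in
      B + bnd x (2 + a) i S + 2
      + B * (bnd (f (1 + a)%nat i) (2 + a) (1 + i) (S + B) + 6)
  end.

(* Relates a register-allocated expression to its interpretation: the contexts
   list the registers of the variables in scope with their values. *)
Inductive wf (GN : list (nat * nat)) (GR : list (nat * R)) :
  forall t, exp nat nat t -> exp nat R t -> Prop :=
| wf_nvar r v : In (r, v) GN -> wf GN GR TN (ENVar r) (ENVar v)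
| wf_rvar r v : In (r, v) GR -> wf GN GR TR (ERVar r) (ERVar v)
| wf_lit c : wf GN GR TN (ELit c) (ELit c)
| wf_add e1 e2 e1' e2' :
    wf GN GR TN e1 e1' -> wf GN GR TN e2 e2' ->
    wf GN GR TN (EAdd e1 e2) (EAdd e1' e2')
| wf_sum b f b' f' :
    wf GN GR TN b b' ->
    (forall r v, wf ((r, v) :: GN) GR TN (f r) (f' v)) ->
    wf GN GR TN (ESum b f) (ESum b' f')
| wf_if t c e1 e2 c' e1' e2' :
    wf GN GR TR c c' -> wf GN GR t e1 e1' -> wf GN GR t e2 e2' ->
    wf GN GR t (EIf c e1 e2) (EIf c' e1' e2')
| wf_inp e e' : wf GN GR TN e e' -> wf GN GR TR (EInp e) (EInp e')
| wf_nat e e' : wf GN GR TN e e' -> wf GN GR TR (ENat e) (ENat e')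
| wf_sub e1 e2 e1' e2' :
    wf GN GR TR e1 e1' -> wf GN GR TR e2 e2' ->
    wf GN GR TR (ESub e1 e2) (ESub e1' e2')
| wf_fold b x f b' x' f' :
    wf GN GR TN b b' -> wf GN GR TR x x' ->
    (forall r v r' v', wf ((r, v) :: GN) ((r', v') :: GR) TR (f r r') (f' v v')) ->
    wf GN GR TR (EFold b x f) (EFold b' x' f').

Arguments wf GN GR {t} _ _.

Lemma wf_weaken GN GR t (e : exp nat nat t) e' :
  wf GN GR e e' -> forall HN HR, incl GN HN -> incl GR HR -> wf HN HR e e'.
Proof.
  assert (incl_both : forall A (x : A) l l', incl l l' -> incl (x :: l) (x :: l'))
    by (intros A x l l' H; apply incl_cons; [left; reflexivity|now apply incl_tl]).
  induction 1; intros HN HR iN iR; constructor; auto.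
Qed.

Lemma nsum_le n g B : (forall k, (k < n)%nat -> (g k <= B)%nat) -> (nsum n g <= n * B)%nat.
Proof.
  induction n as [|n IH]; intros H; simpl; [lia|].
  pose proof (H n (Nat.lt_succ_diag_r n)).
  assert (nsum n g <= n * B)%nat by (apply IH; intros; apply H; lia). lia.
Qed.

(** Integer values serve as loop counts, so they need bounds. Real values need none: they influence
    integers only through tests, and [bnd] adds up both branches. *)
Lemma eval_le_bnd inp GN GR t (e : exp nat nat t) e' :
  wf GN GR e e' -> forall a i S, (forall r v, In (r, v) GN -> (v <= S)%nat) ->
  match t return val t -> Prop with
  | TN => fun v => (v <= bnd e a i S)%nat
  | TR => fun _ => True
  end (eval inp e').
Proof.
  induction 1 as [GN GR r v Hr|GN GR r v Hr|GN GR c|GN GR e1 e2 e1' e2' _ IH1 _ IH2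
    |GN GR b f b' f' _ IHb _ IHf|GN GR t c e1 e2 c' e1' e2' _ IHc _ IH1 _ IH2
    |GN GR e e' _ IH|GN GR e e' _ IH|GN GR e1 e2 e1' e2' _ IH1 _ IH2
    |GN GR b x f b' x' f' _ IHb _ IHx _ IHf]; intros a i S HS; cbn [eval bnd]; auto.
  - apply HS in Hr. lia.
  - specialize (IH1 a i S HS). specialize (IH2 (1 + a)%nat i S HS).
    cbv beta iota in *. lia.
  - specialize (IHb a i S HS). cbv beta iota zeta in *.
    set (B := bnd b a i S) in *.
    set (F := bnd (f (2 + a)%nat) (3 + a) i (S + B)).
    assert (H : (nsum (eval inp b') (fun k => eval inp (f' k)) <= eval inp b' * F)%nat).
    { apply nsum_le. intros k Hk.
      apply (IHf (2 + a)%nat k (3 + a)%nat i (S + B)%nat).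
      intros r v [E|Hr]; [injection E as <- <-|apply HS in Hr]; lia. }
    etransitivity; [exact H|]. etransitivity; [apply Nat.mul_le_mono_r; exact IHb|].
    fold F. nia.
  - specialize (IH1 a i S HS). specialize (IH2 a i S HS).
    destruct t; [|exact I]. destruct (Rlt_dec 0 (eval inp c')); lia.
Qed.

(** * Correctness of compiled expressions *)

Definition post (t : ty) (a i h : nat) (s : store) (v : val t) (s' : store) : Prop :=
  match t return val t -> Prop with
  | TN => fun v => fst s' a = v
  | TR => fun v => snd s' i = v
  end v /\
  (forall x, (x < a)%nat -> fst s' x = fst s x) /\
  (forall x, (x < i)%nat \/ (h <= x)%nat -> snd s' x = snd s x).

(** Scratch space starts at [a] and [i], above all variables in scope. [4 <= a] protects the
    parameters and the input address; [ready_h] keeps real scratch registers below the input. *)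
Record ready (inp : nat -> R) GN GR (a i S h : nat) (s : store) : Prop := {
  ready_a : (4 <= a)%nat;
  ready_N : forall r v, In (r, v) GN -> (r < a)%nat /\ fst s r = v /\ (v <= S)%nat;
  ready_R : forall r v, In (r, v) GR -> (r < i)%nat /\ snd s r = v;
  ready_h : (h <= fst s 3%nat)%nat;
  ready_S : (fst s 3%nat <= S)%nat;
  ready_inp : forall x, snd s (fst s 3%nat + x)%nat = inp x }.

Lemma ready_change inp GN GR a i S h s a' i' S' h' s' :
  ready inp GN GR a i S h s ->
  (a <= a')%nat -> (i <= i')%nat -> (S <= S')%nat -> (h' <= h)%nat ->
  (forall x, (x < a)%nat -> fst s' x = fst s x) ->
  (forall x, (x < i)%nat \/ (h <= x)%nat -> snd s' x = snd s x) ->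
  ready inp GN GR a' i' S' h' s'.
Proof.
  intros [Ha HN HR Hh HS Hi] La Li LS Lh EN ER.
  assert (E3 : fst s' 3%nat = fst s 3%nat) by (apply EN; lia).
  split; rewrite ?E3; try lia.
  - intros r v Hr. apply HN in Hr as (H1 & H2 & H3). rewrite EN by lia.
    repeat split; auto; lia.
  - intros r v Hr. apply HR in Hr as (H1 & H2). rewrite ER by lia.
    split; auto; lia.
  - intros x. rewrite ER by lia. apply Hi.
Qed.

Lemma ready_cons_N inp GN GR a i S h s r v :
  ready inp GN GR a i S h s -> (r < a)%nat -> fst s r = v -> (v <= S)%nat ->
  ready inp ((r, v) :: GN) GR a i S h s.
Proof.
  intros [] H1 H2 H3. split; auto.
  intros r' v' [E|Hr]; [injection E as <- <-|]; auto.
Qed.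

Lemma ready_cons_R inp GN GR a i S h s r v :
  ready inp GN GR a i S h s -> (r < i)%nat -> snd s r = v ->
  ready inp GN ((r, v) :: GR) a i S h s.
Proof.
  intros [] H1 H2. split; auto.
  intros r' v' [E|Hr]; [injection E as <- <-|]; auto.
Qed.

Ltac frame :=
  let x := fresh "x" in intros x ?;
  repeat match goal with
  | H : forall y : nat, _ -> fst _ y = fst _ y |- _ => specialize (H x)
  | H : forall y : nat, _ -> _ -> fst _ y = fst _ y |- _ => specialize (H x)
  | H : forall y : nat, _ -> snd _ y = snd _ y |- _ => specialize (H x)
  | H : forall y : nat, snd _ y = snd _ y |- _ => specialize (H x)
  end; cbn [act step fst snd nth_error nreg rreg] in *; unfold updN, updR in *;
  repeat match goal with
  | H : context [Nat.eqb x ?y] |- _ => destruct (Nat.eqb_spec x y); try lia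
  | |- context [Nat.eqb x ?y] => destruct (Nat.eqb_spec x y); try lia
  end;
  repeat match goal with
  | H : ?P -> ?Q -> _ = _ |- _ =>
     let H' := fresh in assert (H' : P) by lia; specialize (H H'); clear H'
  | H : ?P -> _ = _ |- _ =>
     let H' := fresh in assert (H' : P) by lia; specialize (H H'); clear H'
  end; congruence.

Ltac ready_from H := eapply ready_change; [exact H|lia|lia|lia|lia|frame|frame].

Lemma eval_le_bnd_ready inp GN GR (e : exp nat nat TN) e' a i S h s a' i' :
  wf GN GR e e' -> ready inp GN GR a i S h s -> (eval inp e' <= bnd e a' i' S)%nat.
Proof.
  intros W HR. apply (eval_le_bnd inp GN GR TN e e' W a' i' S).
  intros r v H. now apply (ready_N _ _ _ _ _ _ _ _ HR) in H.
Qed.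

(** By induction on [wf], the hypothesis for a loop body holds for every register and value; it is
    used at the register picked by [code] and at the value of the current round. *)
Theorem code_correct inp GN GR t (e : exp nat nat t) e' :
  wf GN GR e e' -> forall a i S s,
  ready inp GN GR a i S (top e a i) s ->
  does (code e a i) s (bnd e a i S) (post t a i (top e a i) s (eval inp e')).
Proof.
  induction 1 as [GN GR r v Hr|GN GR r v Hr|GN GR c|GN GR e1 e2 e1' e2' W1 IH1 W2 IH2
    |GN GR b f b' f' Wb IHb Wf IHf|GN GR t c e1 e2 c' e1' e2' Wc IHc W1 IH1 W2 IH2
    |GN GR e e' W IH|GN GR e e' W IH|GN GR e1 e2 e1' e2' W1 IH1 W2 IH2
    |GN GR b x f b' x' f' Wb IHb Wx IHx Wf IHf]; intros a i S s HR;
  cbn [code top bnd eval]; cbn [top] in HR.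
  - destruct (ready_N _ _ _ _ _ _ _ _ HR _ _ Hr) as (H1 & H2 & H3).
    eapply does_weaken; [apply does_op; [reflexivity|]| |intros s' H; exact H]; [|lia].
    split; [|split; [frame|frame]]. upd.
  - destruct (ready_R _ _ _ _ _ _ _ _ HR _ _ Hr) as (H1 & H2).
    (* A real copy is an addition of zero; the zero comes from subtracting register [1 + i] from
       itself. *)
    eapply (does_op_seq _ _ _ 1); [reflexivity|]. apply does_op; [reflexivity|].
    split; [|split; [frame|frame]]. upd. lra.
  - eapply does_weaken; [apply does_set_lit|lia|].
    intros s' (H1 & H2 & H3). split; [exact H1|split; [frame|frame]].
  - assert (R1 : ready inp GN GR a i S (top e1 a i) s) by ready_from HR.
    eapply does_seq; [exact (IH1 _ _ _ _ R1)| |].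
    + intros s1 (V1 & N1 & X1).
      assert (R2 : ready inp GN GR (1 + a) i S (top e2 (1 + a) i) s1) by ready_from HR.
      eapply does_seq; [exact (IH2 _ _ _ _ R2)| |apply le_n].
      intros s2 (V2 & N2 & X2).
      eapply does_weaken; [apply (does_add_into a (1 + a) s2); lia| |].
      * rewrite V2. apply Nat.add_le_mono_l, Nat.mul_le_mono_l.
        exact (eval_le_bnd_ready _ _ _ _ _ _ _ _ _ _ (1 + a) i W2 HR).
      * intros s3 (V3 & N3 & X3). split; [|split; [frame|frame]].
        rewrite V3, V2, N2, V1 by lia. reflexivity.
    + lia.
  - pose proof (eval_le_bnd_ready _ _ _ _ _ _ _ _ _ _ a i Wb HR) as HB.
    set (B := bnd b a i S) in *. cbv zeta.
    set (F := bnd (f (2 + a)%nat) (3 + a) i (S + B)).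
    assert (R1 : ready inp GN GR a i S (top b a i) s) by ready_from HR.
    eapply (does_seq _ _ _ B (1 + (1 + (1 + (1 + B * (5 * F + 5)))))%nat);
      [exact (IHb _ _ _ _ R1)| |].
    + intros s1 (V1 & N1 & X1).
      apply does_op_seq; [reflexivity|]. apply does_op_seq; [reflexivity|].
      apply does_op_seq; [reflexivity|].
      set (s2 := act _ _).
      assert (E1 : fst s2 (1 + a)%nat = eval inp b') by (subst s2; rewrite <- V1; upd).
      assert (E0 : fst s2 a = 0%nat) by (subst s2; upd).
      assert (E2 : fst s2 (2 + a)%nat = 0%nat) by (subst s2; upd).
      assert (N2 : forall x, (x < a)%nat -> fst s2 x = fst s x) by (subst s2; frame).
      assert (X2 : forall x, (x < i)%nat \/ (top b a i <= x)%nat -> snd s2 x = snd s x)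
        by (subst s2; frame).
      clearbody s2. clear s1 V1 N1 X1.
      eapply does_weaken; [apply (does_loop (fun j s' =>
         let k := fst s' (2 + a)%nat in
         (k + j = eval inp b')%nat /\ fst s' a = nsum k (fun k => eval inp (f' k)) /\
         (forall x, (x < a)%nat -> fst s' x = fst s x) /\
         (forall x, (x < i)%nat \/
            (max (top b a i) (top (f (2 + a)%nat) (3 + a) i) <= x)%nat ->
            snd s' x = snd s x)) _ _ _ (5 * F + 2)%nat)| |].
      * cbv zeta. rewrite E1, E2, E0. repeat split; auto. frame.
      * cbv zeta. intros j s3 Hj (I1 & I2 & N3 & X3).
        set (k := fst s3 (2 + a)%nat) in *.
        (* The counter stays below the number of rounds, which is at most [B]; so [S + B] bounds all
           variables of the body. *)
        assert (Rd : ready inp ((2 + a, k) :: GN)%nat GR (3 + a) i (S + B)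
                 (top (f (2 + a)%nat) (3 + a) i) (act (NDec (1 + a)) s3)).
        { apply ready_cons_N; [ready_from HR|lia|subst k; upd|lia]. }
        pose proof (eval_le_bnd_ready _ _ _ _ _ _ _ _ _ _ (3 + a) i (Wf _ _) Rd) as HF.
        fold F in HF.
        eapply (does_seq _ _ _ F (2 + 4 * F)); [exact (IHf _ _ _ _ _ _ Rd)| |].
        -- intros s4 (V4 & N4 & X4).
           eapply (does_seq _ _ _ (1 + 4 * F) 1); [|cbv beta|lia].
           { eapply does_weaken; [apply (does_add_into a (3 + a)); lia| |].
             - rewrite V4; lia.
             - intros s' H; exact H. }
           intros s5 (V5 & N5 & X5). apply does_op; [reflexivity|].
           assert (F1 : fst s5 (1 + a)%nat = j)
             by (rewrite N5, N4 by lia; upd).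
           assert (F2 : fst s5 (2 + a)%nat = k)
             by (rewrite N5, N4 by lia; subst k; upd).
           assert (F0 : fst s5 a = nsum (1 + k) (fun k => eval inp (f' k))).
           { rewrite V5, V4, N4 by lia. cbn [nsum plus]. rewrite <- I2. upd. }
           assert (G2 : fst (act (NInc (2 + a)) s5) (2 + a)%nat = (1 + k)%nat)
             by (rewrite <- F2; upd).
           split; [rewrite <- F1; upd|]. rewrite G2.
           split; [lia|]. split; [rewrite <- F0; upd|]. split; frame.
        -- lia.
      * intros s' _ H; exact H.
      * rewrite E1. nia.
      * cbv beta zeta. intros s3 (I1 & I2 & N3 & X3).
        split; [|split; [frame|frame]]. rewrite I2. f_equal. lia.
    + lia.
  - assert (R1 : ready inp GN GR a i S (top c a i) s) by ready_from HR.
    eapply does_seq; [exact (IHc _ _ _ _ R1)| |].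
    + intros s1 (V1 & N1 & X1).
      apply (does_if _ _ _ _ (bnd e1 a i S + bnd e2 a i S)); rewrite V1; intros Hc;
        destruct (Rlt_dec 0 (eval inp c')); try contradiction.
      * assert (R2 : ready inp GN GR a i S (top e1 a i) s1) by ready_from HR.
        eapply does_weaken; [exact (IH1 _ _ _ _ R2)|lia|].
        intros s2 (V2 & N2 & X2). split; [exact V2|split; frame].
      * assert (R2 : ready inp GN GR a i S (top e2 a i) s1) by ready_from HR.
        eapply does_weaken; [exact (IH2 _ _ _ _ R2)|lia|].
        intros s2 (V2 & N2 & X2). split; [exact V2|split; frame].
    + lia.
  - assert (R1 : ready inp GN GR a i S (top e a i) s) by ready_from HR.
    eapply does_seq; [exact (IH _ _ _ _ R1)| |].
    + intros s1 (V1 & N1 & X1). apply (does_op_seq _ _ _ (2 + 4 * S)%nat); [reflexivity|].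
      eapply (does_seq _ _ _ (1 + 4 * S) 1); [|cbv beta|lia].
      { eapply does_weaken; [apply (does_add_into a (1 + a)); lia| |intros s' H; exact H].
        pose proof (ready_a _ _ _ _ _ _ _ _ HR). pose proof (ready_S _ _ _ _ _ _ _ _ HR).
        replace (fst (act (NCopy (1 + a) 3) s1) (1 + a)%nat) with (fst s1 3%nat) by upd.
        rewrite N1 by lia. lia. }
      intros s2 (V2 & N2 & X2). apply does_op; [reflexivity|].
        split; [|split; [frame|frame]].
        cbn [act step fst snd nth_error nreg rreg]. unfold updR at 1.
        rewrite Nat.eqb_refl, X2, V2.
        pose proof (ready_a _ _ _ _ _ _ _ _ HR). pose proof (ready_h _ _ _ _ _ _ _ _ HR).
        replace (fst (act (NCopy (1 + a) 3) s1) a) with (fst s1 a) by upd.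
        replace (fst (act (NCopy (1 + a) 3) s1) (1 + a)%nat) with (fst s1 3%nat) by upd.
        rewrite V1, N1, (Nat.add_comm (eval inp e')) by lia.
        rewrite <- (ready_inp _ _ _ _ _ _ _ _ HR).
        change (snd (act (NCopy (1 + a) 3) s1)) with (snd s1). apply X1. lia.
    + lia.
  - assert (R1 : ready inp GN GR a i S (top e a i) s) by ready_from HR.
    eapply does_seq; [exact (IH _ _ _ _ R1)| |].
    + intros s1 (V1 & N1 & X1). apply does_op; [reflexivity|].
      split; [|split; [frame|frame]]. rewrite <- V1. upd.
    + lia.
  - assert (R1 : ready inp GN GR a i S (top e1 a i) s) by ready_from HR.
    eapply does_seq; [exact (IH1 _ _ _ _ R1)| |].
    + intros s1 (V1 & N1 & X1).
      assert (R2 : ready inp GN GR a (1 + i) S (top e2 a (1 + i)) s1) by ready_from HR.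
      eapply does_seq; [exact (IH2 _ _ _ _ R2)| |apply le_n].
      intros s2 (V2 & N2 & X2). apply does_op; [reflexivity|].
      split; [|split; [frame|frame]].
      rewrite <- V1, <- V2, <- (X2 i) by lia. upd.
    + lia.
  - pose proof (eval_le_bnd_ready _ _ _ _ _ _ _ _ _ _ a i Wb HR) as HB.
    set (B := bnd b a i S) in *. cbv zeta.
    set (F := bnd (f (1 + a)%nat i) (2 + a) (1 + i) (S + B)).
    assert (R1 : ready inp GN GR a i S (top b a i) s) by ready_from HR.
    set (X := bnd x (2 + a) i S).
    eapply (does_seq _ _ _ B (1 + (X + (1 + B * (F + 6))))%nat);
      [exact (IHb _ _ _ _ R1)| |].
    + intros s1 (V1 & N1 & X1).
      apply does_op_seq; [reflexivity|].
      set (s2 := act _ _).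
      assert (E0 : fst s2 a = eval inp b') by (subst s2; rewrite <- V1; upd).
      assert (E1 : fst s2 (1 + a)%nat = 0%nat) by (subst s2; upd).
      assert (N2 : forall x, (x < a)%nat -> fst s2 x = fst s x) by (subst s2; frame).
      assert (X2 : forall x, (x < i)%nat \/ (top b a i <= x)%nat -> snd s2 x = snd s x)
        by (subst s2; frame).
      clearbody s2. clear s1 V1 N1 X1.
      assert (R2 : ready inp GN GR (2 + a) i S (top x (2 + a) i) s2) by ready_from HR.
      eapply does_seq; [exact (IHx _ _ _ _ R2)| |apply le_n].
      intros s3 (V3 & N3 & X3).
      eapply does_weaken; [apply (does_loop (fun j s' =>
         let k := fst s' (1 + a)%nat in
         (k + j = eval inp b')%nat /\
         snd s' i = iterR k (fun k y => eval inp (f' k y)) (eval inp x') /\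
         (forall x, (x < a)%nat -> fst s' x = fst s x) /\
         (forall y, (y < i)%nat \/
            (max (3 + i) (max (top b a i)
              (max (top x (2 + a) i) (top (f (1 + a)%nat i) (2 + a) (1 + i)))) <= y)%nat ->
            snd s' y = snd s y)) _ _ _ (F + 3)%nat)| |].
      * cbv zeta. rewrite !N3, E1, E0 by lia. repeat split; auto; frame.
      * cbv zeta. intros j s4 Hj (I1 & I2 & N4 & X4).
        set (k := fst s4 (1 + a)%nat) in *.
        (* For the body, the accumulator is a real variable holding the current content of register
           [i]. *)
        assert (Rd : ready inp ((1 + a, k) :: GN)%nat ((i, snd s4 i) :: GR)
                 (2 + a) (1 + i) (S + B)
                 (top (f (1 + a)%nat i) (2 + a) (1 + i)) (act (NDec a) s4)).
        { apply ready_cons_R; [|lia|reflexivity].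
          apply ready_cons_N; [ready_from HR|lia|subst k; upd|lia]. }
        eapply does_seq; [exact (IHf _ _ _ _ _ _ _ _ Rd)| |].
        -- intros s5 (V5 & N5 & X5).
           apply (does_op_seq _ _ _ 2); [reflexivity|].
           apply (does_op_seq _ _ _ 1); [reflexivity|].
           apply does_op; [reflexivity|].
           set (s6 := act _ _).
           assert (F0 : fst s6 a = j).
           { transitivity (fst s5 a); [subst s6; upd|]. rewrite N5 by lia. upd. }
           assert (F1 : fst s6 (1 + a)%nat = (1 + k)%nat).
           { transitivity (1 + fst s5 (1 + a)%nat)%nat; [subst s6; upd|].
             rewrite N5 by lia. subst k; upd. }
           assert (F2 : snd s6 i = eval inp (f' k (snd s4 i)))
             by (rewrite <- V5; subst s6; upd; lra).
           split; [exact F0|]. rewrite F1. split; [lia|].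
           split; [rewrite F2, I2; reflexivity|]. subst s6; split; frame.
        -- fold F. lia.
      * intros s' _ H; exact H.
      * rewrite N3, E0 by lia. nia.
      * cbv beta zeta. intros s4 (I1 & I2 & N4 & X4).
        split; [|split; [frame|frame]]. rewrite I2. f_equal. lia.
    + lia.
Qed.

(** * Polynomial time and input relocation *)

(** The final bound is a bare power of the size, without a constant factor. From 2 on, constants and
    sums are absorbed by raising the exponent. *)
Definition poly (F : nat -> nat) : Prop :=
  exists k, forall S, (2 <= S)%nat -> (F S <= S ^ k)%nat.

Lemma poly_const c : poly (fun _ => c).
Proof.
  exists c. intros S HS. pose proof (Nat.pow_gt_lin_r S c). lia.
Qed.

Lemma poly_id : poly (fun S => S).
Proof. exists 1%nat. intros S HS. rewrite Nat.pow_1_r. lia. Qed.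

Lemma poly_mul F G : poly F -> poly G -> poly (fun S => F S * G S)%nat.
Proof.
  intros [k Hk] [l Hl]. exists (k + l)%nat. intros S HS.
  rewrite Nat.pow_add_r. apply Nat.mul_le_mono; auto.
Qed.

(** Both terms are at most [S ^ (k + l)]; the extra factor [S], at least 2, absorbs their sum. *)
Lemma poly_add F G : poly F -> poly G -> poly (fun S => F S + G S)%nat.
Proof.
  intros [k Hk] [l Hl]. exists (1 + (k + l))%nat. intros S HS.
  specialize (Hk S HS). specialize (Hl S HS).
  pose proof (Nat.pow_le_mono_r S k (k + l)). pose proof (Nat.pow_le_mono_r S l (k + l)).
  cbn [plus Nat.pow]. nia.
Qed.

Lemma poly_comp F G :
  poly F -> poly G -> (forall S, (2 <= S)%nat -> (2 <= G S)%nat) ->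
  poly (fun S => F (G S)).
Proof.
  intros [k Hk] [l Hl] HG. exists (l * k)%nat. intros S HS.
  rewrite Nat.pow_mul_r. etransitivity; [apply Hk; auto|].
  apply Nat.pow_le_mono_l; auto.
Qed.

Ltac poly := repeat first
  [ assumption | apply poly_const | apply poly_id
  | apply poly_mul | apply poly_add ].

(** For a fixed expression, each loop multiplies by a polynomial count and enlarges the variable
    bound polynomially; the exponent depends on the expression only. *)
Lemma bnd_poly t (e : exp nat nat t) : forall a i, poly (bnd e a i).
Proof.
  induction e as [x|x|c|e1 IH1 e2 IH2|b IHb f IHf|t c IHc e1 IH1 e2 IH2
    |e IH|e IH|e1 IH1 e2 IH2|b IHb x IHx f IHf]; intros a i; cbn [bnd]; cbv zeta.
  - poly.
  - poly.
  - poly.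
  - specialize (IH1 a i). specialize (IH2 (1 + a)%nat i). poly.
  - specialize (IHb a i).
    assert (poly (fun S => bnd (f (2 + a)%nat) (3 + a) i (S + bnd b a i S))).
    { apply poly_comp; [apply IHf|poly|intros; lia]. }
    poly.
  - specialize (IHc a i). specialize (IH1 a i). specialize (IH2 a i). poly.
  - specialize (IH a i). poly.
  - specialize (IH a i). poly.
  - specialize (IH1 a i). specialize (IH2 a (1 + i)%nat). poly.
  - specialize (IHb a i). specialize (IHx (2 + a)%nat i).
    assert (poly (fun S => bnd (f (1 + a)%nat i) (2 + a) (1 + i) (S + bnd b a i S))).
    { apply poly_comp; [apply IHf|poly|intros; lia]. }
    poly.
Qed.

(** * Moving the input out of the scratch registers *)

Definition mul_into (a b c e : nat) : cmd :=
  Op (NCopy b c) ;; Loop b (Op (NCopy (1 + b) e) ;; Loop (1 + b) (Op (NInc a))).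

Lemma does_mul_into a b c e s z :
  (a <> b -> a <> 1 + b -> e <> b -> e <> 1 + b -> e <> a ->
   fst s c <= z -> fst s e <= z ->
  does (mul_into a b c e) s (2 + z * (4 * z + 5))
    (fun s' => fst s' a = fst s a + fst s c * fst s e /\
       (forall x, x <> a -> x <> b -> x <> 1 + b -> fst s' x = fst s x) /\
       (forall x, snd s' x = snd s x)))%nat.
Proof.
  intros Hab Hab1 Heb Heb1 Hea Hc He.
  apply (does_op_seq _ _ _ (1 + z * (4 * z + 5))); [reflexivity|].
  set (s1 := act _ _).
  assert (E : fst s1 b = fst s c) by (subst s1; upd).
  assert (N1 : forall x, x <> b -> fst s1 x = fst s x) by (subst s1; intros; upd).
  assert (X1 : forall x, snd s1 x = snd s x) by (subst s1; intros; upd).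
  clearbody s1.
  eapply does_weaken; [apply (does_loop (fun j s' =>
      (fst s' a + j * fst s e = fst s a + fst s c * fst s e)%nat /\
      (forall x, x <> a -> x <> b -> x <> (1 + b)%nat -> fst s' x = fst s x) /\
      (forall x, snd s' x = snd s x)) _ _ _ (2 + 4 * z)%nat)| |].
  - rewrite E, N1 by auto. repeat split; auto.
  - intros j s2 Hj (I1 & N2 & X2).
    apply (does_op_seq _ _ _ (1 + 4 * z)); [reflexivity|].
    set (s3 := act _ _).
    assert (E3 : fst s3 (1 + b)%nat = fst s e).
    { rewrite <- (N2 e) by auto. subst s3. upd. }
    assert (E0 : fst s3 b = j) by (subst s3; upd).
    assert (Ea : fst s3 a = fst s2 a) by (subst s3; upd).
    assert (N3 : forall x, x <> a -> x <> b -> x <> (1 + b)%nat -> fst s3 x = fst s x)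
      by (intros; rewrite <- N2 by auto; subst s3; upd).
    assert (X3 : forall x, snd s3 x = snd s x) by (intros; rewrite <- X2; subst s3; upd).
    clearbody s3.
    eapply does_weaken; [apply does_add_into; lia|lia|].
    cbv beta. intros s4 (V4 & N4 & X4). repeat split.
    + rewrite N4 by lia. exact E0.
    + rewrite V4, Ea, E3. lia.
    + intros x H1 H2 H3. rewrite N4 by auto. auto.
    + intros x. rewrite X4. auto.
  - intros s' _ H. exact H.
  - rewrite E. nia.
  - cbv beta. intros s' (I1 & N2 & X2). repeat split; auto. lia.
Qed.

(** An indirect copy passes through a real register and would destroy the input cell there. The
    first [k] cells are therefore stored directly, by literal register number. *)
Fixpoint save (k : nat) : cmd :=
  match k with
  | O => Op (NCopy 4 3)
  | S k => save k ;; Op (RStore k 4) ;; Op (NInc 4)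
  end.

Lemma does_save k s :
  (k <= fst s 3%nat)%nat ->
  does (save k) s (1 + 2 * k)
    (fun s' => fst s' 4%nat = (fst s 3 + k)%nat /\
       (forall x, x <> 4%nat -> fst s' x = fst s x) /\
       (forall x, (x < k)%nat -> snd s' (fst s 3 + x)%nat = snd s x) /\
       (forall y, (y < fst s 3 \/ fst s 3 + k <= y)%nat -> snd s' y = snd s y)).
Proof.
  induction k as [|k IH]; intros Hk; cbn [save].
  - apply does_op; [reflexivity|]. repeat split; intros; upd; lia.
  - eapply (does_seq _ _ _ (1 + 2 * k) 2); [apply IH; lia| |lia].
    cbv beta. intros s1 (V1 & N1 & X1 & Y1).
    apply (does_op_seq _ _ _ 1); [reflexivity|]. apply does_op; [reflexivity|].
    repeat split.
    + upd.
    + intros x Hx. rewrite <- N1 by auto. upd.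
    + intros x Hx. destruct (Nat.eq_dec x k) as [->|Hn].
      * rewrite <- (Y1 k) by lia. upd.
      * rewrite <- X1 by lia. upd.
    + intros y Hy. rewrite <- Y1 by lia. upd.
Qed.

(** Register 0 is free for transit once saved. The loop runs once per input cell although the first
    ones are already copied; this avoids a subtraction, and the surplus cells read are zero. *)
Definition copy_rest : cmd :=
  Loop 6 (Op (RLoad 0 5) ;; Op (RStore 0 4) ;; Op (NInc 5) ;; Op (NInc 4)).

Lemma does_copy_rest K (s : store) (X0 : nat -> R) :
  let L := fst s 3%nat in
  (1 <= K)%nat -> fst s 5%nat = K -> fst s 4%nat = (L + K)%nat -> L = (K + fst s 6%nat)%nat ->
  (forall x, (x < K)%nat -> snd s (L + x)%nat = X0 x) ->
  (forall y, (y < L \/ L + K <= y)%nat -> snd s y = X0 y) ->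
  (forall x, (fst s 6%nat <= x)%nat -> X0 x = 0) ->
  does copy_rest s (1 + 7 * fst s 6%nat)
    (fun s' => (forall x, (x < 4)%nat -> fst s' x = fst s x) /\
       forall x, snd s' (L + x)%nat = X0 x).
Proof.
  intros L HK H5 H4 HL HX HY H0.
  eapply does_weaken; [apply (does_loop (fun j s' =>
      (fst s' 5%nat + j = L)%nat /\ fst s' 4%nat = (L + fst s' 5%nat)%nat /\
      (K <= fst s' 5%nat)%nat /\
      (forall x, (x < 4)%nat -> fst s' x = fst s x) /\
      (forall x, (x < fst s' 5%nat)%nat -> snd s' (L + x)%nat = X0 x) /\
      (* Cell 0 is excluded, being the transit register; as [1 <= K], it is never read as a
         source. *)
      (forall y, (1 <= y < L \/ L + fst s' 5%nat <= y)%nat -> snd s' y = X0 y)) _ _ _ 4%nat)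
    | |].
  - rewrite H5. repeat split; auto; try lia. intros y Hy. apply HY. lia.
  - intros j s1 Hj (I1 & I2 & I3 & N1 & X1 & Y1).
    apply (does_op_seq _ _ _ 3); [reflexivity|]. apply (does_op_seq _ _ _ 2); [reflexivity|].
    apply (does_op_seq _ _ _ 1); [reflexivity|]. apply does_op; [reflexivity|].
    set (s2 := act _ _).
    assert (E5 : fst s2 5%nat = (1 + fst s1 5%nat)%nat) by (subst s2; upd).
    rewrite E5. split; [subst s2; upd|]. split; [lia|].
    split; [subst s2; upd|]. split; [lia|]. split.
    { intros x Hx. rewrite <- N1 by auto. subst s2. upd. }
    split.
    + intros x Hx. destruct (Nat.eq_dec x (fst s1 5%nat)) as [->|Hn].
      * rewrite <- (Y1 (fst s1 5%nat)) by lia. subst s2. upd.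
      * rewrite <- X1 by lia. subst s2. upd.
    + intros y Hy. rewrite <- Y1 by lia. subst s2. upd.
  - intros s' _ H. exact H.
  - lia.
  - cbv beta. intros s' (I1 & I2 & I3 & N1 & X1 & Y1). split; [exact N1|].
    intros x. destruct (Nat.lt_ge_cases x (fst s' 5%nat)) as [Hx|Hx]; [auto|].
    rewrite Y1, !H0 by lia. reflexivity.
Qed.

(* Moves the input out of the first [K] real registers, which the rest of the
   program uses as scratch space; its new address goes to integer register 3. *)
Definition prelude (K : nat) : cmd :=
  Op (NCopy 6 0) ;; Op (NInc 6) ;; mul_into 6 4 0 2 ;; mul_into 6 4 1 2 ;;
  set_lit 3 K ;; Op (NCopy 4 6) ;; Loop 4 (Op (NInc 3)) ;;
  save K ;; set_lit 5 K ;; copy_rest.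

Definition prelude_cost (K z : nat) : nat :=
  (14 + 4 * K + 2 * (z * (4 * z + 5)) + 11 * z)%nat.

Lemma does_prelude K n m d s z :
  let L := (1 + n + n * d + m * d)%nat in
  (1 <= K)%nat -> fst s 0%nat = n -> fst s 1%nat = m -> fst s 2%nat = d ->
  (L <= z)%nat -> (n <= z)%nat -> (m <= z)%nat -> (d <= z)%nat ->
  (forall x, (L <= x)%nat -> snd s x = 0) ->
  does (prelude K) s (prelude_cost K z)
    (fun s' => fst s' 0%nat = n /\ fst s' 1%nat = m /\ fst s' 2%nat = d /\
       fst s' 3%nat = (K + L)%nat /\ forall x, snd s' (K + L + x)%nat = snd s x).
Proof.
  intros L HK Hn Hm Hd Hz Hnz Hmz Hdz H0.
  set (Y := (z * (4 * z + 5))%nat).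
  apply (does_le _ _ (1 + (1 + ((2 + Y) + ((2 + Y) + ((1 + K) + (1 + ((1 + 4 * z) +
    ((1 + 2 * K) + ((1 + K) + (1 + 7 * z)))))))))));
    [|unfold prelude_cost; lia].
  apply does_op_seq; [reflexivity|]. apply does_op_seq; [reflexivity|].
  set (s1 := act _ _).
  assert (A6 : fst s1 6%nat = (1 + n)%nat) by (subst s1; upd).
  assert (A0 : fst s1 0%nat = n) by (subst s1; upd).
  assert (A1 : fst s1 1%nat = m) by (subst s1; upd).
  assert (A2 : fst s1 2%nat = d) by (subst s1; upd).
  assert (AX : forall x, snd s1 x = snd s x) by (subst s1; intros; upd).
  clearbody s1.
  eapply does_seq; [apply (does_mul_into 6 4 0 2 s1 z); lia| |apply le_n].
  intros s2 (V2 & N2 & X2).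
  eapply does_seq; [apply (does_mul_into 6 4 1 2 s2 z); rewrite ?N2 by lia; lia| |apply le_n].
  intros s3 (V3 & N3 & X3).
  rewrite (N2 1%nat), (N2 2%nat), V2, A0, A1, A2, A6 in V3 by lia.
  change (fst s3 6%nat = L) in V3.
  eapply does_seq; [apply does_set_lit| |apply le_n].
  intros s4 (V4 & N4 & X4).
  apply does_op_seq; [reflexivity|].
  set (s5 := act _ _).
  assert (B3 : fst s5 3%nat = K) by (subst s5; upd).
  assert (B4 : fst s5 4%nat = L) by (rewrite <- V3, <- N4 by lia; subst s5; upd).
  assert (B6 : fst s5 6%nat = L) by (rewrite <- V3, <- N4 by lia; subst s5; upd).
  assert (BN : forall x, (x < 3)%nat -> fst s5 x = fst s1 x)
    by (intros; rewrite <- N2, <- N3, <- N4 by lia; subst s5; upd).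
  assert (BX : forall x, snd s5 x = snd s x)
    by (intros; rewrite <- AX, <- X2, <- X3, <- X4; subst s5; upd).
  clearbody s5.
  eapply (does_seq _ _ _ (1 + 4 * z));
    [eapply does_le; [apply (does_add_into 3 4 s5); lia|lia]| |apply le_n].
  cbv beta. intros s6 (V6 & N6 & X6).
  rewrite B3, B4 in V6.
  eapply does_seq; [apply (does_save K s6); lia| |apply le_n].
  cbv beta. rewrite V6. intros s7 (V7 & N7 & X7 & Y7).
  eapply does_seq; [apply does_set_lit| |apply le_n].
  intros s8 (V8 & N8 & X8).
  assert (C3 : fst s8 3%nat = (K + L)%nat) by (rewrite N8, N7 by lia; lia).
  assert (C6 : fst s8 6%nat = L) by (rewrite N8, N7, N6 by lia; lia).
  eapply does_weaken; [apply (does_copy_rest K s8 (snd s))| |]; rewrite ?C3, ?C6; auto.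
  - rewrite N8 by lia. lia.
  - intros x Hx. rewrite X8, X7, X6, BX by lia. reflexivity.
  - intros x Hx. rewrite X8, Y7, X6, BX by lia. reflexivity.
  - lia.
  - cbv beta. intros s9 (N9 & X9).
    assert (E : forall x, (x < 3)%nat -> fst s9 x = fst s1 x).
    { intros x Hx. rewrite N9, N8, N7, N6, BN by lia. reflexivity. }
    repeat split; rewrite ?E by lia; auto. rewrite N9 by lia. exact C3.
Qed.

(** A single [E] yields a uniform program; [wf] ties it to a meaning that depends on the parameters
    in registers 0 to 2. Register 3 is the input address, so integer scratch starts at 4. *)
Theorem decision_program (E : exp nat nat TR) (E' : nat -> nat -> nat -> exp nat R TR) :
  (forall n m d, wf [(0, n); (1, m); (2, d)]%nat [] E (E' n m d)) ->
  exists (M : program) (k : nat), forall n m d (inp : list R),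
    (1 <= n)%nat -> length inp = (1 + n + n * d + m * d)%nat ->
    exists b, decides_within M n m d inp b (input_size n m d ^ k) /\
      (b = true <-> 0 < eval (fun x => nth x inp 0) (E' n m d)).
Proof.
  intros W. set (K := (1 + top E 4 0)%nat).
  set (c := prelude K ;; code E 4 0 ;; IfPos 0 (Op (NZero 0) ;; Op (NInc 0)) (Op (NZero 0))).
  assert (HP : poly (fun z => prelude_cost K z + (bnd E 4 0 (K + z) + 4))%nat).
  { unfold prelude_cost. poly.
    apply (poly_comp (bnd E 4 0) (fun z => K + z)%nat);
      [apply bnd_poly|poly|intros; lia]. }
  destruct HP as [k Hk].
  exists (assemble 0 c), k. intros n m d inp Hn Hlen.
  set (z := input_size n m d). set (I := fun x => nth x inp 0).
  set (s0 := (nreg (init_state n m d inp), rreg (init_state n m d inp)) : store).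
  assert (D : does c s0 (z ^ k)
    (fun s' => negb (Nat.eqb (fst s' 0%nat) 0) = true <-> 0 < eval I (E' n m d))).
  { apply (does_le _ _ (prelude_cost K z + (bnd E 4 0 (K + z) + 4)));
      (* The size is at least 2 because [1 <= n]. *)
      [|apply Hk; unfold z, input_size; lia].
    eapply does_seq; [apply (does_prelude K n m d s0 z)| |apply le_n];
      try reflexivity; try (unfold K, z, input_size; nia).
    { intros x Hx. apply nth_overflow. rewrite Hlen. exact Hx. }
    set (L := (1 + n + n * d + m * d)%nat).
    intros s1 (V0 & V1 & V2 & V3 & X1).
    eapply does_seq; [apply (code_correct I _ _ _ _ _ (W n m d) 4 0 (K + z))| |apply le_n].
    { split.
      - lia.
      - unfold z, input_size.
        intros r v [H|[H|[H|[]]]]; injection H as <- <-; repeat split; auto; lia.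
      - intros r v [].
      - rewrite V3. unfold K. lia.
      - rewrite V3. unfold L, z, input_size. nia.
      - intros x. rewrite V3, X1. reflexivity. }
    intros s2 (V & _ & _). cbv beta iota in V.
    apply (does_if _ _ _ _ 2); rewrite V; intros Hc.
    - apply (does_op_seq _ _ _ 1); [reflexivity|]. apply does_op; [reflexivity|].
      simpl. tauto.
    - eapply does_le; [apply does_op; [reflexivity|]|].
      + simpl. split; [discriminate|tauto].
      + lia. }
  destruct D as (t & s' & Ht & Hex & Hb).
  exists (negb (Nat.eqb (fst s' 0%nat) 0)). split; [|exact Hb].
  pose proof (assemble_correct _ _ _ _ Hex 0 (assemble 0 c) (code_at_self _ [])) as Hrun.
  change (MState 0 (fst s0) (snd s0)) with (init_state n m d inp) in Hrun.
  exists t. split; [exact Ht|]. rewrite Hrun. split; [|reflexivity].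
  unfold halted. simpl. lia.
Qed.

(** * Reduction to finitely many distance bounds *)

Lemma iterR_ext n g g' x x' :
  x = x' -> (forall k y, (k < n)%nat -> g k y = g' k y) -> iterR n g x = iterR n g' x'.
Proof.
  intros <-. induction n as [|n IH]; intros H; simpl; [reflexivity|].
  rewrite IH by (intros; apply H; lia). apply H. lia.
Qed.

Lemma Rmax_le_iff x y r : Rmax x y <= r <-> x <= r /\ y <= r.
Proof.
  split; [intros H; split; [exact (Rle_trans _ _ _ (Rmax_l x y) H)|
    exact (Rle_trans _ _ _ (Rmax_r x y) H)]|].
  intros [Hx Hy]. now apply Rmax_lub.
Qed.

Lemma iterR_max_le n g x r :
  iterR n (fun k y => Rmax y (g k)) x <= r <->
  x <= r /\ forall k, (k < n)%nat -> g k <= r.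
Proof.
  induction n as [|n IH]; cbn [iterR].
  - split; [intros H; split; [exact H|intros; lia]|tauto].
  - rewrite Rmax_le_iff, IH. split.
    + intros [[H1 H2] H3]. split; [exact H1|]. intros k Hk.
      destruct (Nat.eq_dec k n) as [->|]; [exact H3|apply H2; lia].
    + intros [H1 H2]. repeat split; auto.
Qed.

Lemma iterR_le_min n g x r :
  r <= iterR n (fun k y => Rmin y (g k)) x <->
  r <= x /\ forall k, (k < n)%nat -> r <= g k.
Proof.
  induction n as [|n IH]; cbn [iterR].
  - split; [intros H; split; [exact H|intros; lia]|tauto].
  - split.
    + intros H.
      pose proof (Rmin_l (iterR n (fun k y => Rmin y (g k)) x) (g n)).
      pose proof (Rmin_r (iterR n (fun k y => Rmin y (g k)) x) (g n)).
      destruct (proj1 IH) as [Hx Hg]; [lra|]. split; [exact Hx|]. intros k Hk.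
      destruct (Nat.eq_dec k n) as [->|]; [lra|apply Hg; lia].
    + intros [H1 H2]. apply Rmin_glb; [apply IH; split; auto|auto].
Qed.

Definition Rsum (n : nat) (g : nat -> R) : R := fold_right Rplus 0 (map g (seq 0 n)).

Lemma Rsum_S n g : Rsum (S n) g = Rsum n g + g n.
Proof.
  unfold Rsum. rewrite seq_S, map_app, fold_right_app. simpl.
  generalize (map g (seq 0 n)). intros l. induction l as [|y l IH]; simpl; lra.
Qed.

Lemma iterR_sum n g x : iterR n (fun k y => y + g k) x = x + Rsum n g.
Proof.
  induction n as [|n IH]; simpl; [unfold Rsum; simpl; lra|]. rewrite IH, Rsum_S. lra.
Qed.

Lemma Rsum_le n g g' : (forall k, (k < n)%nat -> g k <= g' k) -> Rsum n g <= Rsum n g'.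
Proof.
  induction n as [|n IH]; intros H; [apply Rle_refl|]. rewrite !Rsum_S.
  apply Rplus_le_compat; auto.
Qed.

Lemma Rsum_ext n g g' : (forall k, (k < n)%nat -> g k = g' k) -> Rsum n g = Rsum n g'.
Proof. intros H. apply Rle_antisym; apply Rsum_le; intros; rewrite H; auto; lra. Qed.

Lemma Rsum_ge_term n g j :
  (forall k, 0 <= g k) -> (j < n)%nat -> g j <= Rsum n g.
Proof.
  intros H. assert (P : forall l, 0 <= Rsum l g).
  { intros l. induction l as [|l IH]; [unfold Rsum; simpl; lra|].
    rewrite Rsum_S. specialize (H l). lra. }
  induction n as [|n IH]; intros Hj; [lia|]. rewrite Rsum_S.
  destruct (Nat.eq_dec j n) as [->|]; [specialize (P n)|specialize (H n)]; [lra|].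
  assert (g j <= Rsum n g) by (apply IH; lia). lra.
Qed.

Lemma nsum_count n (P : nat -> bool) :
  nsum n (fun k => if P k then 1 else 0)%nat = length (filter P (seq 0 n)).
Proof.
  induction n as [|n IH]; [reflexivity|].
  rewrite seq_S, filter_app, length_app, <- IH. simpl. now destruct (P n).
Qed.

Lemma nsum_ext n g g' :
  (forall k, (k < n)%nat -> g k = g' k) -> nsum n g = nsum n g'.
Proof.
  induction n as [|n IH]; intros H; simpl; [reflexivity|].
  rewrite IH by (intros; apply H; lia). rewrite H by lia. reflexivity.
Qed.

(** Balls are boxes, which makes the test coordinatewise. The conjunct [0 <= r] is the initial value
    of the fold and matters when [d] is 0. *)
Lemma linf_dist_le d p q r :
  linf_dist d p q <= r <-> 0 <= r /\ forall i, (i < d)%nat -> Rabs (p i - q i) <= r.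
Proof.
  unfold linf_dist.
  assert (H : fold_right Rmax 0 (map (fun i => Rabs (p i - q i)) (seq 0 d)) <= r <->
    0 <= r /\ forall x, In x (map (fun i => Rabs (p i - q i)) (seq 0 d)) -> x <= r).
  { generalize (map (fun i => Rabs (p i - q i)) (seq 0 d)). intros l.
    induction l as [|y l IH]; simpl; [tauto|]. rewrite Rmax_le_iff, IH.
    split; [intros (H1 & H2 & H3); split; [exact H2|intros x [<-|]; auto]|].
    intros (H1 & H2). repeat split; auto. }
  rewrite H. split; intros [H1 H2]; (split; [exact H1|]).
  - intros i Hi. apply H2, in_map_iff. exists i. split; [reflexivity|].
    apply in_seq. lia.
  - intros x Hx. apply in_map_iff in Hx as (i & <- & Hi). apply in_seq in Hi.
    apply H2. lia.
Qed.

Lemma linf_dist_pos d p q : 0 <= linf_dist d p q.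
Proof. apply (proj1 (linf_dist_le d p q _) (Rle_refl _)). Qed.

Lemma linf_dist_iterR d p q :
  linf_dist d p q = iterR d (fun i y => Rmax y (Rabs (p i - q i))) 0.
Proof.
  apply Rle_antisym.
  - apply linf_dist_le, iterR_max_le, Rle_refl.
  - apply iterR_max_le, linf_dist_le, Rle_refl.
Qed.

Lemma linf_dist_near d v p q eps :
  0 <= eps -> (forall i, (i < d)%nat -> Rabs (q i - p i) <= eps) ->
  linf_dist d v q <= linf_dist d v p + eps.
Proof.
  intros He H. apply linf_dist_le. pose proof (linf_dist_pos d v p). split; [lra|].
  intros i Hi. specialize (H i Hi).
  pose proof (proj2 (proj1 (linf_dist_le d v p _) (Rle_refl _)) i Hi).
  replace (v i - q i) with ((v i - p i) - (q i - p i)) by lra.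
  eapply Rle_trans; [apply Rabs_triang|]. rewrite Rabs_Ropp. lra.
Qed.

(** This and the next two definitions restate ballots for an arbitrary table of distances; on tables
    given by points they are convertible to the original notions. *)
Definition ahead (D : nat -> R) (k j : nat) : bool :=
  if Rlt_dec (D k) (D j) then true
  else if Req_EM_T (D k) (D j) then Nat.eqb k 0 else false.

Definition rk (n : nat) (D : nat -> R) (j : nat) : nat :=
  S (length (filter (fun k => andb (negb (Nat.eqb k j)) (ahead D k j)) (seq 0 n))).

Definition wins (n m : nat) (f : nat -> R) (D : nat -> nat -> R) : Prop :=
  forall j, (j < n)%nat ->
    Rsum m (fun v => f (rk n (D v) j)) <= Rsum m (fun v => f (rk n (D v) 0)).

Lemma ahead_true D k j : ahead D k j = true <-> D k < D j \/ (D k = D j /\ k = 0%nat).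
Proof.
  unfold ahead. destruct (Rlt_dec (D k) (D j)); [tauto|].
  destruct (Req_EM_T (D k) (D j)); rewrite ?Nat.eqb_eq; intuition (try discriminate; lra).
Qed.

Lemma length_filter_le A (P Q : A -> bool) l :
  (forall x, In x l -> P x = true -> Q x = true) ->
  (length (filter P l) <= length (filter Q l))%nat.
Proof.
  induction l as [|x l IH]; intros H; simpl; [lia|].
  specialize (IH (fun y Hy => H y (or_intror Hy))).
  specialize (H x (or_introl eq_refl)).
  destruct (P x); [rewrite H by reflexivity|destruct (Q x)]; simpl; lia.
Qed.

Lemma length_filter_lt A (P : A -> bool) l x :
  In x l -> P x = false -> (length (filter P l) < length l)%nat.
Proof.
  induction l as [|y l IH]; intros Hx HP; [destruct Hx|]. simpl.
  destruct Hx as [->|Hx].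
  - rewrite HP. pose proof (filter_length_le P l). lia.
  - specialize (IH Hx HP). destruct (P y); simpl; lia.
Qed.

(** Keeps ranks in the range where [f] is monotone and where its values are part of the input; [j]
    itself is never counted. *)
Lemma rk_le n D j : (j < n)%nat -> (rk n D j <= n)%nat.
Proof.
  intros Hj. unfold rk. rewrite <- (length_seq n 0) at 2.
  apply (length_filter_lt _ _ _ j); [apply in_seq; lia|].
  now rewrite Nat.eqb_refl.
Qed.

(** Since ties favour the target, its rank depends only on the set of candidates strictly closer.
    Comparing these sets, not the target's distances, also covers a target that moves away without
    being overtaken. *)
Lemma rk_target_mono n D D' :
  (forall k, (1 <= k < n)%nat -> D k = D' k) ->
  (forall k, (1 <= k < n)%nat -> D k < D 0%nat -> D' k < D' 0%nat) ->
  (rk n D 0 <= rk n D' 0)%nat.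
Proof.
  intros HE H. apply le_n_S, length_filter_le. intros k Hk.
  apply in_seq in Hk. rewrite !Bool.andb_true_iff, !ahead_true.
  destruct k as [|k]; [easy|]. intros [_ [Hl|[_ Hl]]]; [|lia].
  split; [reflexivity|]. left. apply H; [lia|exact Hl].
Qed.

Lemma rk_other_mono n D D' j :
  (1 <= j < n)%nat ->
  (forall k, (1 <= k < n)%nat -> D k = D' k) ->
  (forall k, (1 <= k < n)%nat -> D k < D 0%nat -> D' k < D' 0%nat) ->
  (rk n D' j <= rk n D j)%nat.
Proof.
  intros Hj HE H. apply le_n_S, length_filter_le. intros k Hk.
  apply in_seq in Hk. rewrite !Bool.andb_true_iff, !ahead_true.
  intros [Hkj Hl]. split; [exact Hkj|].
  destruct (Nat.eq_dec k 0) as [->|Hk0].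
  - destruct (Rtotal_order (D 0%nat) (D j)) as [Hlt|[Heq|Hlt]]; [now left|now right|].
    apply H in Hlt; [|exact Hj]. destruct Hl; lra.
  - rewrite !HE by lia. exact Hl.
Qed.

(** Used in both directions of the reduction: from an actual position to the capped table, and
    back. *)
Lemma wins_mono n m f (D D' : nat -> nat -> R) :
  (forall s t, (1 <= s)%nat -> (s <= t)%nat -> (t <= n)%nat -> f t <= f s) ->
  (forall v k, (v < m)%nat -> (1 <= k < n)%nat -> D v k = D' v k) ->
  (forall v k, (v < m)%nat -> (1 <= k < n)%nat ->
     D v k < D v 0%nat -> D' v k < D' v 0%nat) ->
  wins n m f D' -> wins n m f D.
Proof.
  intros Hf HE HD HW j Hj. destruct (Nat.eq_dec j 0) as [->|Hj0]; [apply Rle_refl|].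
  eapply Rle_trans; [|eapply Rle_trans; [exact (HW j Hj)|]];
    apply Rsum_le; intros v Hv; apply Hf; try (apply rk_le; lia); try (unfold rk; lia).
  - apply rk_other_mono; auto; lia.
  - apply rk_target_mono; auto.
Qed.

(** * Guessing distance bounds *)

Section Reduction.

Variables (n m d : nat) (eps : R) (f : nat -> R) (C V : nat -> point).

Definition cdist (v k : nat) : R := linf_dist d (V v) (C k).

(* Index 0 encodes the absence of a constraint: no admissible position of the
   target, and no other candidate, is this far from the voter. *)
Definition threshold (v k : nat) : R :=
  if Nat.eqb k 0 then eps + 1 + Rsum n (cdist v) else cdist v k.

Definition capped (kap : nat -> nat) (v k : nat) : R :=
  if Nat.eqb k 0 then threshold v (kap v) else cdist v k.

Definition lower (kap : nat -> nat) (i : nat) : R :=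
  iterR m (fun v y => Rmax y (V v i - threshold v (kap v))) (C 0%nat i - eps).

Definition upper (kap : nat -> nat) (i : nat) : R :=
  iterR m (fun v y => Rmin y (V v i + threshold v (kap v))) (C 0%nat i + eps).

Definition good (kap : nat -> nat) : Prop :=
  (forall i, (i < d)%nat -> lower kap i <= upper kap i) /\ wins n m f (capped kap).

(** The search determines a guess on voters below [m] only; this replaces an appeal to functional
    extensionality. *)
Lemma good_ext kap kap' :
  (forall v, (v < m)%nat -> kap v = kap' v) -> good kap -> good kap'.
Proof.
  intros H [H1 H2]. split.
  - intros i Hi. specialize (H1 i Hi).
    replace (lower kap' i) with (lower kap i);
      [replace (upper kap' i) with (upper kap i); [exact H1|]|];
      (apply iterR_ext; [reflexivity|]); intros v y Hv; now rewrite H.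
  - intros j Hj. specialize (H2 j Hj).
    assert (E : forall l, Rsum m (fun v => f (rk n (capped kap' v) l)) =
                          Rsum m (fun v => f (rk n (capped kap v) l))).
    { intros l. apply Rsum_ext. intros v Hv. unfold capped. now rewrite H. }
    now rewrite !E.
Qed.

(** Selects the bound for one voter at distance [x] from the target: no candidate is at a distance
    in the half-open interval from [x] to [D k]. *)
Lemma nearest_not_below (D : nat -> R) x l :
  (exists k, (1 <= k < l)%nat /\ x <= D k /\
     forall k', (1 <= k' < l)%nat -> D k' < D k -> D k' < x) \/
  (forall k', (1 <= k' < l)%nat -> D k' < x).
Proof.
  induction l as [|l IH]; [right; intros; lia|].
  destruct IH as [(k & Hk & Hx & Hmin)|Hall].
  - left. destruct (Rle_dec x (D l)) as [Hl|Hl];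
      [destruct (Rle_dec (D k) (D l)) as [Hkl|Hkl]|].
    + exists k. split; [lia|split; [assumption|]]. intros k' Hk' Hlt.
      destruct (Nat.eq_dec k' l) as [->|]; [lra|]. apply Hmin; [lia|lra].
    + exists l. split; [lia|split; [assumption|]]. intros k' Hk' Hlt.
      destruct (Nat.eq_dec k' l) as [->|]; [lra|]. apply Hmin; [lia|lra].
    + exists k. split; [lia|split; [assumption|]]. intros k' Hk' Hlt.
      destruct (Nat.eq_dec k' l) as [->|]; [lra|]. apply Hmin; [lia|lra].
  - destruct (Nat.eq_dec l 0) as [->|Hl0]; [right; intros; lia|].
    destruct (Rle_dec x (D l)) as [Hl|Hl].
    + left. exists l. split; [lia|split; [assumption|]]. intros k' Hk' Hlt.
      destruct (Nat.eq_dec k' l) as [->|]; [lra|]. apply Hall. lia.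
    + right. intros k' Hk'. destruct (Nat.eq_dec k' l) as [->|]; [lra|apply Hall; lia].
Qed.

Lemma threshold_choice (D : nat -> R) :
  (1 <= n)%nat -> 0 < eps ->
  (forall v, (v < m)%nat -> D v <= cdist v 0 + eps) ->
  exists kap, forall v, (v < m)%nat ->
    (kap v < n)%nat /\ D v <= threshold v (kap v) /\
    forall k, (1 <= k < n)%nat -> cdist v k < threshold v (kap v) -> cdist v k < D v.
Proof.
  intros Hn He HD.
  assert (H : forall v, exists k, (v < m)%nat ->
    (k < n)%nat /\ D v <= threshold v k /\
    forall k', (1 <= k' < n)%nat -> cdist v k' < threshold v k -> cdist v k' < D v).
  { intros v. destruct (nearest_not_below (cdist v) (D v) n) as [(k & Hk & Hx & Hmin)|Hall].
    - exists k. intros _. unfold threshold.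
      destruct (Nat.eqb_spec k 0); [lia|]. repeat split; auto; lia.
    - exists 0%nat. intros Hv. unfold threshold. simpl. repeat split; auto.
      (* The target moves by at most [eps], and the sum dominates its original distance; [Hall] says
         that every other candidate is already strictly closer than the target. *)
      pose proof (Rsum_ge_term n (cdist v) 0 (fun k => linf_dist_pos _ _ _) Hn).
      specialize (HD v Hv). lra. }
  (* Finite choice, by induction on the number of voters treated. *)
  clear HD. assert (HC : forall l, exists kap : nat -> nat, forall v, (v < l)%nat -> (v < m)%nat ->
    (kap v < n)%nat /\ D v <= threshold v (kap v) /\
    forall k, (1 <= k < n)%nat -> cdist v k < threshold v (kap v) -> cdist v k < D v).
  { induction l as [|l [kap IH]]; [exists (fun v => v); intros; lia|].
    destruct (H l) as [k Hk]. exists (fun v => if Nat.eqb v l then k else kap v).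
    intros v Hv Hvm. destruct (Nat.eqb_spec v l) as [->|]; [exact (Hk Hvm)|].
    apply IH; [lia|exact Hvm]. }
  destruct (HC m) as [kap Hk]. exists kap. intros v Hv. now apply Hk.
Qed.

Lemma threshold_pos v k : 0 < eps -> 0 <= threshold v k.
Proof.
  intros He. unfold threshold. destruct (Nat.eqb k 0); [|apply linf_dist_pos].
  destruct n as [|n']; [unfold Rsum; simpl; lra|].
  pose proof (Rsum_ge_term (S n') (cdist v) 0 (fun k => linf_dist_pos _ _ _) (Nat.lt_0_succ _)).
  pose proof (linf_dist_pos d (V v) (C 0%nat) : 0 <= cdist v 0). lra.
Qed.

Lemma control_iff_good :
  valid_instance n m d eps f C V ->
  constructive_control n m d eps f C V <->
  exists kap, (forall v, (v < m)%nat -> (kap v < n)%nat) /\ good kap.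
Proof.
  intros (Hn & He & Hf & _). split.
  - intros (ct & Hct & HW).
    destruct (threshold_choice (fun v => linf_dist d (V v) ct) Hn He) as [kap Hk].
    { intros v _. apply linf_dist_near; [lra|exact Hct]. }
    exists kap. split; [intros v Hv; now apply Hk|]. split.
    (* The manipulated position lies in every box, hence between the two ends. *)
    + intros i Hi. apply Rle_trans with (ct i).
      * apply iterR_max_le. split; [specialize (Hct i Hi); split_Rabs; lra|].
        intros v Hv. destruct (Hk v Hv) as (_ & H & _).
        apply linf_dist_le in H as [_ H]. specialize (H i Hi). split_Rabs; lra.
      * apply iterR_le_min. split; [specialize (Hct i Hi); split_Rabs; lra|].
        intros v Hv. destruct (Hk v Hv) as (_ & H & _).
        apply linf_dist_le in H as [_ H]. specialize (H i Hi). split_Rabs; lra.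
    + eapply (wins_mono n m f _ (fun v k => linf_dist d (V v) (moved C ct k)));
        [exact Hf| | |exact HW].
      * intros v [|k] Hv Hk1; [lia|reflexivity].
      * intros v [|k] Hv Hk1; [lia|]. apply Hk; [exact Hv|exact Hk1].
  (* Any point of the intersection would do; its lower corner is explicit. *)
  - intros (kap & Hk & Hbox & HW). exists (lower kap).
    assert (Hlo : forall i, (i < d)%nat -> C 0%nat i - eps <= lower kap i /\
       forall v, (v < m)%nat -> V v i - threshold v (kap v) <= lower kap i)
      by (intros i _; apply iterR_max_le, Rle_refl).
    assert (Hup : forall i, (i < d)%nat -> lower kap i <= C 0%nat i + eps /\
       forall v, (v < m)%nat -> lower kap i <= V v i + threshold v (kap v))
      by (intros i Hi; apply iterR_le_min, Hbox, Hi).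
    split.
    + intros i Hi. destruct (Hlo i Hi), (Hup i Hi). split_Rabs; lra.
    + change (wins n m f (fun v k => linf_dist d (V v) (moved C (lower kap) k))).
      eapply wins_mono; [exact Hf| | |exact HW].
      * intros v [|k] Hv Hk1; [lia|reflexivity].
      * intros v [|k] Hv Hk1; [lia|]. change (cdist v (S k) < linf_dist d (V v) (lower kap) ->
          cdist v (S k) < threshold v (kap v)).
        (* The corner is within the voter's bound, so whoever is closer than the corner is closer
           than the bound. *)
        intros Hlt. eapply Rlt_le_trans; [exact Hlt|].
        apply linf_dist_le. split; [now apply threshold_pos|].
        intros i Hi. destruct (Hlo i Hi) as [_ H1], (Hup i Hi) as [_ H2].
        specialize (H1 v Hv). specialize (H2 v Hv). split_Rabs; lra.
Qed.

End Reduction.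

(** * The search as an expression *)

Lemma length_blocks (g : nat -> nat -> R) d l :
  length (flat_map (fun j => map (g j) (seq 0 d)) l) = (length l * d)%nat.
Proof.
  induction l as [|j l IH]; simpl; [reflexivity|].
  now rewrite length_app, length_map, length_seq, IH.
Qed.

Lemma nth_blocks (g : nat -> nat -> R) d i : (i < d)%nat ->
  forall n b j, (j < n)%nat ->
  nth (j * d + i) (flat_map (fun j => map (g j) (seq 0 d)) (seq b n)) 0 = g (b + j)%nat i.
Proof.
  intros Hi. induction n as [|n IH]; intros b j Hj; [lia|].
  cbn [seq flat_map]. destruct j as [|j].
  - rewrite app_nth1 by (rewrite length_map, length_seq; lia).
    rewrite (nth_indep _ 0 (g b 0%nat)) by (rewrite length_map, length_seq; lia).
    rewrite map_nth, seq_nth by lia. f_equal; lia.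
  - rewrite app_nth2; rewrite length_map, length_seq; [|simpl; lia].
    replace (S j * d + i - d)%nat with (j * d + i)%nat by (simpl; lia).
    rewrite IH by lia. f_equal; lia.
Qed.

Section Encoding.

Variables (n m d : nat) (eps : R) (f : nat -> R) (C V : nat -> point).

Let inp (x : nat) : R := nth x (encode n m d eps f C V) 0.

Lemma length_encode :
  length (encode n m d eps f C V) = (1 + n + n * d + m * d)%nat.
Proof.
  unfold encode. cbn [length].
  rewrite !length_app, length_map, !length_blocks, !length_seq. lia.
Qed.

(** [eps] in cell 0 shifts the scores so that a rank is the address of its own score. *)
Lemma encode_score t : (1 <= t <= n)%nat -> inp t = f t.
Proof.
  intros Ht. unfold inp, encode. destruct t as [|t]; [lia|]. cbn [nth].
  rewrite app_nth1 by (rewrite length_map, length_seq; lia).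
  rewrite (nth_indep _ 0 (f 0%nat)) by (rewrite length_map, length_seq; lia).
  rewrite map_nth, seq_nth by lia. reflexivity.
Qed.

Lemma encode_candidate j i :
  (j < n)%nat -> (i < d)%nat -> inp (1 + (n + (j * d + i)))%nat = C j i.
Proof.
  intros Hj Hi. unfold inp, encode. cbn [nth plus].
  rewrite app_nth2; rewrite length_map, length_seq; [|lia].
  replace (n + (j * d + i) - n)%nat with (j * d + i)%nat by lia.
  rewrite app_nth1 by (rewrite length_blocks, length_seq; nia).
  apply (nth_blocks C d i Hi n 0 j Hj).
Qed.

Lemma encode_voter v i :
  (v < m)%nat -> (i < d)%nat -> inp (1 + (n + (n * d + (v * d + i))))%nat = V v i.
Proof.
  intros Hv Hi. unfold inp, encode. cbn [nth plus].
  rewrite app_nth2; rewrite length_map, length_seq; [|lia].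
  rewrite app_nth2; rewrite length_blocks, length_seq; [|lia].
  replace (n + (n * d + (v * d + i)) - n - n * d)%nat with (v * d + i)%nat by lia.
  apply (nth_blocks V d i Hi m 0 v Hv).
Qed.

End Encoding.

(** * Expressions for testing one guess *)

Section Program.

Context {VN VR : Type}.
Notation nexp := (exp VN VR TN).
Notation rexp := (exp VN VR TR).

Definition e0 : rexp := ENat (ELit 0).
Definition e1 : rexp := ENat (ELit 1).
(** Subtraction is the only real arithmetic of the language; sums, absolute values and extrema are
    derived from it and tests. *)
Definition eplus (x y : rexp) : rexp := ESub x (ESub e0 y).
Definition eabs (x : rexp) : rexp := EIf x x (ESub e0 x).
Definition emax (x y : rexp) : rexp := EIf (ESub x y) x y.
Definition emin (x y : rexp) : rexp := EIf (ESub x y) y x.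
Definition emul (x y : nexp) : nexp := ESum x (fun _ => y).

(* Conditions are real expressions, read as true when positive. *)
Definition ele (x y : rexp) : rexp := EIf (ESub x y) e0 e1.
Definition eand (x y : rexp) : rexp := EIf x y e0.
Definition eall (b : nexp) (c : VN -> rexp) : rexp :=
  EFold b e1 (fun k y => EIf (ERVar y) (c k) e0).
Definition eex (b : nexp) (c : VN -> rexp) : rexp :=
  EFold b e0 (fun k y => EIf (ERVar y) e1 (c k)).

Variables n m d : nexp.

Definition ecand (j : nexp) (i : VN) : rexp :=
  EInp (EAdd (ELit 1) (EAdd n (EAdd (emul j d) (ENVar i)))).
Definition evoter (v : nexp) (i : VN) : rexp :=
  EInp (EAdd (ELit 1) (EAdd n (EAdd (emul n d) (EAdd (emul v d) (ENVar i))))).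
Definition eeps : rexp := EInp (ELit 0).

Definition edist (v k : nexp) : rexp :=
  EFold d e0 (fun i y => emax (ERVar y) (eabs (ESub (evoter v i) (ecand k i)))).

Definition ethreshold (v k : nexp) : rexp :=
  EIf (ENat k) (edist v k)
    (EFold n (eplus eeps e1) (fun j y => eplus (ERVar y) (edist v (ENVar j)))).

Variable kap : VN -> nexp.

Definition ecapped (v : VN) (k : nexp) : rexp :=
  EIf (ENat k) (edist (ENVar v) k) (ethreshold (ENVar v) (kap v)).

Definition elower (i : VN) : rexp :=
  EFold m (ESub (ecand (ELit 0) i) eeps)
    (fun v y => emax (ERVar y) (ESub (evoter (ENVar v) i) (ethreshold (ENVar v) (kap v)))).

Definition eupper (i : VN) : rexp :=
  EFold m (eplus (ecand (ELit 0) i) eeps)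
    (fun v y => emin (ERVar y) (eplus (evoter (ENVar v) i) (ethreshold (ENVar v) (kap v)))).

(** No equality test is needed. For [k > 0] the strict comparison already fails at [k = j]. For
    [k = 0] a tie counts as ahead, so the reverse strict comparison is negated, and [k = j = 0] is
    caught by the test on [j]. *)
Definition erank (v : VN) (j : nexp) : nexp :=
  EAdd (ELit 1) (ESum n (fun k =>
    EIf (ENat (ENVar k))
      (EIf (ESub (ecapped v j) (ecapped v (ENVar k))) (ELit 1) (ELit 0))
      (EIf (ENat j)
        (EIf (ESub (ecapped v (ELit 0)) (ecapped v j)) (ELit 0) (ELit 1))
        (ELit 0)))).

Definition escore (j : nexp) : rexp :=
  EFold m e0 (fun v y => eplus (ERVar y) (EInp (erank v j))).

Definition egood : rexp :=
  eand (eall d (fun i => ele (elower i) (eupper i)))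
       (eall n (fun j => ele (escore (ENVar j)) (escore (ELit 0)))).

End Program.

(* [kap] is chosen for voters [w - 1], ..., [0] in this order, hence the voters
   above [w] already have their choice. *)
Fixpoint esearch {VN VR} (n m d : exp VN VR TN) (w : nat) (kap : VN -> exp VN VR TN)
  : exp VN VR TR :=
  match w with
  | O => egood n m d kap
  | S w => eex n (fun k => esearch n m d w (fun v =>
      EIf (ESub (ENat (ENVar v)) (ENat (ELit w))) (kap v) (ENVar k)))
  end.

(** Quantified over all larger contexts because [kap] is applied under binders, to voter variables
    introduced later. *)
Definition wf_choice GN GR (kap : nat -> exp nat nat TN) (kap' : nat -> exp nat R TN) :=
  forall HN HR r v, incl GN HN -> incl GR HR -> In (r, v) HN -> wf HN HR (kap r) (kap' v).

Lemma wf_choice_weaken GN GR HN HR kap kap' :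
  wf_choice GN GR kap kap' -> incl GN HN -> incl GR HR -> wf_choice HN HR kap kap'.
Proof. intros H HN' HR' IN IR r v ? ? ?. apply H; eauto using incl_tran. Qed.

Ltac wf_incl := auto 10 using incl_refl, incl_tl.

Ltac wf_weaken_tac :=
  match goal with
  | H : wf _ _ ?x _ |- wf _ _ ?x _ => apply (wf_weaken _ _ _ _ _ H); wf_incl
  | H : wf_choice _ _ ?k _ |- wf _ _ (?k _) _ => apply H; [wf_incl|wf_incl|simpl; auto 10]
  | H : wf_choice _ _ ?k _ |- wf_choice _ _ ?k _ =>
      apply (wf_choice_weaken _ _ _ _ _ _ H); wf_incl
  end.

Ltac wf_with tac :=
  repeat (intros; first [wf_weaken_tac | tac | solve [simpl; auto 10] | constructor]).

Lemma wf_dist GN GR n n' d d' v k v' k' :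
  wf GN GR n n' -> wf GN GR d d' -> wf GN GR v v' -> wf GN GR k k' ->
  wf GN GR (edist n d v k) (edist n' d' v' k').
Proof. intros. unfold edist, emax, eabs, evoter, ecand, emul. wf_with fail. Qed.

Lemma wf_threshold GN GR n n' d d' v k v' k' :
  wf GN GR n n' -> wf GN GR d d' -> wf GN GR v v' -> wf GN GR k k' ->
  wf GN GR (ethreshold n d v k) (ethreshold n' d' v' k').
Proof. intros. unfold ethreshold, eplus, eeps. wf_with ltac:(apply wf_dist). Qed.

Lemma wf_capped GN GR n n' d d' kap kap' r v k k' :
  wf GN GR n n' -> wf GN GR d d' -> wf_choice GN GR kap kap' ->
  In (r, v) GN -> wf GN GR k k' ->
  wf GN GR (ecapped n d kap r k) (ecapped n' d' kap' v k').
Proof.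
  intros. unfold ecapped. wf_with ltac:(first [apply wf_dist | apply wf_threshold]).
Qed.

Lemma wf_score GN GR n n' m m' d d' kap kap' j j' :
  wf GN GR n n' -> wf GN GR m m' -> wf GN GR d d' -> wf_choice GN GR kap kap' ->
  wf GN GR j j' -> wf GN GR (escore n m d kap j) (escore n' m' d' kap' j').
Proof.
  intros. unfold escore, erank, eplus. wf_with ltac:(apply wf_capped).
Qed.

Lemma wf_good GN GR n n' m m' d d' kap kap' :
  wf GN GR n n' -> wf GN GR m m' -> wf GN GR d d' -> wf_choice GN GR kap kap' ->
  wf GN GR (egood n m d kap) (egood n' m' d' kap').
Proof.
  intros. unfold egood, eand, eall, ele, elower, eupper, emax, emin, eplus, evoter, ecand,
    emul, eeps.
  wf_with ltac:(first [apply wf_score | apply wf_threshold]).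
Qed.

Lemma wf_search w : forall GN GR n n' m m' d d' kap kap',
  wf GN GR n n' -> wf GN GR m m' -> wf GN GR d d' -> wf_choice GN GR kap kap' ->
  wf GN GR (esearch n m d w kap) (esearch n' m' d' w kap').
Proof.
  induction w as [|w IH]; intros; cbn [esearch]; [now apply wf_good|].
  unfold eex, e0, e1. constructor; [assumption|repeat constructor|].
  intros r v r' v'. constructor; [constructor; now left|repeat constructor|].
  apply IH; try wf_weaken_tac.
  intros HN HR r1 v1 iN iR Hr.
  assert (In (r, v) HN) by (apply iN; now left).
  assert (wf HN HR (kap r1) (kap' v1)).
  { apply H2; auto; eapply incl_tran; eauto; wf_incl. }
  wf_with fail.
Qed.

(** * Meaning of the search expression *)

Section Evaluation.

Variables (n m d : nat) (eps : R) (f : nat -> R) (C V : nat -> point).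

Let inp (x : nat) : R := nth x (encode n m d eps f C V) 0.

Notation ev := (eval inp).
Notation xn := (@ENVar nat R n).
Notation xm := (@ENVar nat R m).
Notation xd := (@ENVar nat R d).

Lemma eval_plus x y : ev (eplus x y) = ev x + ev y.
Proof. unfold eplus, e0. simpl. lra. Qed.

Lemma eval_abs x : ev (eabs x) = Rabs (ev x).
Proof.
  unfold eabs, e0. cbn [eval]. destruct (Rlt_dec 0 (ev x)); simpl; split_Rabs; lra.
Qed.

Lemma eval_succ x : ev (EAdd (ELit 1) x) = S (ev x).
Proof. reflexivity. Qed.

Lemma eval_sum b g : ev (ESum b g) = nsum (ev b) (fun k => ev (g k)).
Proof. reflexivity. Qed.

Lemma eval_max x y : ev (emax x y) = Rmax (ev x) (ev y).
Proof.
  unfold emax. cbn [eval]. unfold Rmax.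
  destruct (Rlt_dec 0 (ev x - ev y)), (Rle_dec (ev x) (ev y)); lra.
Qed.

Lemma eval_min x y : ev (emin x y) = Rmin (ev x) (ev y).
Proof.
  unfold emin. cbn [eval]. unfold Rmin.
  destruct (Rlt_dec 0 (ev x - ev y)), (Rle_dec (ev x) (ev y)); lra.
Qed.

Lemma eval_mul x y : ev (emul x y) = (ev x * ev y)%nat.
Proof. cbn. induction (ev x) as [|k IH]; simpl; lia. Qed.

Lemma eval_le x y : 0 < ev (ele x y) <-> ev x <= ev y.
Proof.
  unfold ele, e0, e1. cbn [eval]. destruct (Rlt_dec 0 (ev x - ev y)); simpl; lra.
Qed.

Lemma eval_and x y : 0 < ev (eand x y) <-> 0 < ev x /\ 0 < ev y.
Proof.
  unfold eand, e0. cbn [eval]. destruct (Rlt_dec 0 (ev x)); simpl; [tauto|].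
  split; [lra|tauto].
Qed.

Lemma eval_all b c :
  0 < ev (eall b c) <-> forall k, (k < ev b)%nat -> 0 < ev (c k).
Proof.
  unfold eall, e1, e0. cbn [eval]. generalize (ev b : nat). intros l.
  induction l as [|l IH]; cbn [iterR].
  - split; [intros; lia|simpl; lra].
  - destruct (Rlt_dec 0 (iterR _ _ _)) as [Hl|Hl].
    + split; [|intros H; apply H; lia]. intros H k Hk.
      destruct (Nat.eq_dec k l) as [->|]; [exact H|]. apply IH; [exact Hl|lia].
    + split; [simpl; lra|]. intros H. destruct Hl. apply IH. intros; apply H; lia.
Qed.

Lemma eval_ex b c :
  0 < ev (eex b c) <-> exists k, (k < ev b)%nat /\ 0 < ev (c k).
Proof.
  unfold eex, e1, e0. cbn [eval]. generalize (ev b : nat). intros l.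
  induction l as [|l IH]; cbn [iterR].
  - split; [simpl; lra|intros (k & Hk & _); lia].
  - destruct (Rlt_dec 0 (iterR _ _ _)) as [Hl|Hl].
    + split; [|simpl; lra]. intros _. apply IH in Hl as (k & Hk & H).
      exists k. split; [lia|exact H].
    + split; [intros H; exists l; split; [lia|exact H]|].
      intros (k & Hk & H). destruct (Nat.eq_dec k l) as [->|]; [exact H|].
      destruct Hl. apply IH. exists k. split; [lia|exact H].
Qed.

Lemma eval_cand (j : exp nat R TN) i :
  (ev j < n)%nat -> (i < d)%nat -> ev (ecand xn xd j i) = C (ev j) i.
Proof.
  intros Hj Hi. unfold ecand. cbn [eval]. rewrite eval_mul. cbn [eval].
  now apply encode_candidate.
Qed.

Lemma eval_voter (v : exp nat R TN) i :
  (ev v < m)%nat -> (i < d)%nat -> ev (evoter xn xd v i) = V (ev v) i.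
Proof.
  intros Hv Hi. unfold evoter. cbn [eval]. rewrite !eval_mul. cbn [eval].
  now apply encode_voter.
Qed.

Lemma eval_dist (v k : exp nat R TN) :
  (ev v < m)%nat -> (ev k < n)%nat -> ev (edist xn xd v k) = cdist d C V (ev v) (ev k).
Proof.
  intros Hv Hk. unfold cdist. rewrite linf_dist_iterR.
  unfold edist. cbn [eval]. apply iterR_ext; [reflexivity|].
  intros i y Hi. rewrite eval_max, eval_abs. cbn [eval].
  now rewrite eval_voter, eval_cand.
Qed.

Lemma eval_if_nat t k (x y : exp nat R t) :
  ev (EIf (ENat k) x y) = if Nat.eqb (ev k) 0 then ev y else ev x.
Proof.
  cbn [eval]. destruct (Nat.eqb_spec (ev k) 0) as [E|E].
  - rewrite E. destruct (Rlt_dec 0 (INR 0)) as [H|]; [simpl in H; lra|reflexivity].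
  - destruct (Rlt_dec 0 (INR (ev k))) as [|H]; [reflexivity|].
    destruct H. apply lt_0_INR. lia.
Qed.

Lemma eval_threshold (v k : exp nat R TN) :
  (ev v < m)%nat -> (ev k < n)%nat ->
  ev (ethreshold xn xd v k) = threshold n d eps C V (ev v) (ev k).
Proof.
  intros Hv Hk. unfold ethreshold, threshold. rewrite eval_if_nat.
  destruct (Nat.eqb (ev k) 0); [|now apply eval_dist].
  rewrite <- iterR_sum. cbn [eval]. apply iterR_ext.
  - rewrite eval_plus. reflexivity.
  - intros j y Hj. rewrite eval_plus, eval_dist by assumption. reflexivity.
Qed.

Section Choice.

Variable kap : nat -> exp nat R TN.
Hypothesis kap_lt : forall v, (v < m)%nat -> (ev (kap v) < n)%nat.

Let K (v : nat) : nat := ev (kap v).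

Lemma eval_capped v (k : exp nat R TN) :
  (v < m)%nat -> (ev k < n)%nat ->
  ev (ecapped xn xd kap v k) = capped n d eps C V K v (ev k).
Proof.
  intros Hv Hk. unfold ecapped, capped. rewrite eval_if_nat.
  destruct (Nat.eqb (ev k) 0); [apply eval_threshold; auto|now apply eval_dist].
Qed.

Lemma eval_lower i :
  (1 <= n)%nat -> (i < d)%nat -> ev (elower xn xm xd kap i) = lower n m d eps C V K i.
Proof.
  intros Hn Hi. unfold elower, lower. cbn [eval]. apply iterR_ext.
  - rewrite eval_cand by (auto; exact Hn). reflexivity.
  - intros v y Hv. rewrite eval_max. cbn [eval].
    rewrite eval_voter, eval_threshold by auto. reflexivity.
Qed.

Lemma eval_upper i :
  (1 <= n)%nat -> (i < d)%nat -> ev (eupper xn xm xd kap i) = upper n m d eps C V K i.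
Proof.
  intros Hn Hi. unfold eupper, upper. cbn [eval]. apply iterR_ext.
  - rewrite eval_plus, eval_cand by (auto; exact Hn). reflexivity.
  - intros v y Hv. rewrite eval_min, eval_plus. cbn [eval].
    rewrite eval_voter, eval_threshold by auto. reflexivity.
Qed.

Lemma eval_rank v (j : exp nat R TN) :
  (v < m)%nat -> (ev j < n)%nat ->
  ev (erank xn xd kap v j) = rk n (capped n d eps C V K v) (ev j).
Proof.
  intros Hv Hj. unfold erank, rk. rewrite <- nsum_count, eval_succ, eval_sum. f_equal.
  apply nsum_ext. intros k Hk. rewrite !eval_if_nat. cbn [eval].
  assert (H0 : (@eval inp TN (ELit 0) < n)%nat) by (cbn [eval]; lia).
  rewrite !eval_capped by auto. cbn [eval].
  set (D := capped n d eps C V K v). unfold ahead.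
  destruct (Nat.eqb_spec k 0) as [->|Hk0].
  - destruct (Nat.eqb_spec (ev j) 0) as [E|E].
    + rewrite E. reflexivity.
    + rewrite (proj2 (Nat.eqb_neq 0 (ev j))) by auto. cbn [negb andb].
      destruct (Rlt_dec 0 (D 0%nat - D (ev j))), (Rlt_dec (D 0%nat) (D (ev j))),
        (Req_EM_T (D 0%nat) (D (ev j))); try reflexivity; lra.
  - destruct (Nat.eqb_spec k (ev j)) as [<-|E]; cbn [negb andb].
    + destruct (Rlt_dec 0 (D k - D k)); [lra|reflexivity].
    + destruct (Rlt_dec 0 (D (ev j) - D k)), (Rlt_dec (D k) (D (ev j)));
        try reflexivity; try lra.
      destruct (Req_EM_T (D k) (D (ev j))); reflexivity.
Qed.

Lemma eval_score (j : exp nat R TN) :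
  (ev j < n)%nat ->
  ev (escore xn xm xd kap j) = Rsum m (fun v => f (rk n (capped n d eps C V K v) (ev j))).
Proof.
  intros Hj. rewrite <- Rplus_0_l, <- iterR_sum.
  unfold escore. cbn [eval]. apply iterR_ext; [reflexivity|].
  intros v y Hv. rewrite eval_plus. cbn [eval]. rewrite eval_rank by auto.
  f_equal. apply encode_score.
  split; [unfold rk; lia|now apply rk_le].
Qed.

Lemma eval_good : (1 <= n)%nat -> 0 < ev (egood xn xm xd kap) <-> good n m d eps f C V K.
Proof.
  intros Hn. unfold egood, good, wins. rewrite eval_and, !eval_all. cbn [eval].
  assert (H0 : (@eval inp TN (ELit 0) < n)%nat) by exact Hn.
  split; intros [H1 H2]; (split; [intros i Hi; specialize (H1 i Hi)
    |intros j Hj; specialize (H2 j Hj)]).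
  - apply eval_le in H1. now rewrite eval_lower, eval_upper in H1.
  - apply eval_le in H2. now rewrite !eval_score in H2.
  - apply eval_le. now rewrite eval_lower, eval_upper.
  - apply eval_le. now rewrite !eval_score.
Qed.

End Choice.

(** The induction needs partial guesses: [kap] is fixed on voters from [w] on, and the search looks
    for an extension to those below. *)
Lemma eval_search w : forall kap : nat -> exp nat R TN,
  (1 <= n)%nat -> (w <= m)%nat ->
  (forall v, (w <= v < m)%nat -> (ev (kap v) < n)%nat) ->
  0 < ev (esearch xn xm xd w kap) <->
  exists K, (forall v, (v < w)%nat -> (K v < n)%nat) /\
    (forall v, (w <= v < m)%nat -> K v = ev (kap v)) /\ good n m d eps f C V K.
Proof.
  induction w as [|w IH]; intros kap Hn Hw Hkap; cbn [esearch].
  - rewrite eval_good by (auto; intros; apply Hkap; lia). split.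
    + intros H. exists (fun v => ev (kap v)). repeat split; try easy; apply H.
    + intros (K & _ & HK & H).
      apply (good_ext _ _ _ _ _ _ _ K); [|exact H]. intros v Hv. apply HK. lia.
  - rewrite eval_ex. cbn [eval].
    (* Voters below [w] also read [k] at this level, until inner levels override it. *)
    set (kap1 := fun k v => EIf (ESub (ENat (ENVar v)) (ENat (ELit w))) (kap v) (ENVar k)).
    assert (Hw' : (w <= m)%nat) by lia.
    assert (E : forall k v, ev (kap1 k v) = if Nat.ltb w v then ev (kap v) else k).
    { intros k v. unfold kap1. cbn [eval].
      destruct (Nat.ltb_spec w v) as [H|H]; [apply lt_INR in H|apply le_INR in H];
        destruct (Rlt_dec 0 (INR v - INR w)); try reflexivity; exfalso; lra. }
    assert (Hkap1 : forall k, (k < n)%nat ->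
      forall v, (w <= v < m)%nat -> (ev (kap1 k v) < n)%nat).
    { intros k Hk v Hv. rewrite E. destruct (Nat.ltb_spec w v); [|exact Hk].
      apply Hkap. lia. }
    split.
    + intros (k & Hk & H). apply (IH (kap1 k) Hn Hw' (Hkap1 k Hk)) in H as (K & H1 & H2 & H3).
      exists K. repeat split; try apply H3.
      * intros v Hv. destruct (Nat.eq_dec v w) as [->|]; [|apply H1; lia].
        rewrite H2, E, Nat.ltb_irrefl by lia. exact Hk.
      * intros v Hv. rewrite H2, E by lia. now rewrite (proj2 (Nat.ltb_lt w v)) by lia.
    + intros (K & H1 & H2 & H3). exists (K w). split; [apply H1; lia|].
      apply (IH (kap1 (K w)) Hn Hw'); [apply Hkap1, H1; lia|].
      exists K. repeat split; try apply H3.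
      * intros v Hv. apply H1. lia.
      * intros v Hv. rewrite E. destruct (Nat.ltb_spec w v); [apply H2; lia|].
        f_equal. lia.
Qed.

End Evaluation.

(* For every constant number of voters m there is a constant-free
   real-RAM program deciding constructive control (l_infinity, arbitrary
   scoring rule f, given as part of the input) in time polynomial in the
   input size. *)
Theorem theorem11 :
  forall m : nat,
  exists (M : program) (k : nat),
  forall (n d : nat) (eps : R) (f : nat -> R) (C V : nat -> point),
    valid_instance n m d eps f C V ->
    exists b : bool,
      decides_within M n m d (encode n m d eps f C V) b
        ((input_size n m d) ^ k)%nat /\
      (b = true <-> constructive_control n m d eps f C V).
Proof.
  intros m.
  (* The initial guess [ELit 0] is a dummy: every voter below [m] receives its choice from one of
     the [m] levels. *)
  destruct (decision_program
    (esearch (ENVar 0%nat) (ENVar 1%nat) (ENVar 2%nat) m (fun _ => ELit 0))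
    (fun n m' d => esearch (ENVar n) (ENVar m') (ENVar d) m (fun _ => ELit 0)))
    as (M & k & HM).
  { intros n m' d. apply wf_search; try (constructor; simpl; tauto). }
  exists M, k. intros n d eps f C V Hvalid.
  pose proof Hvalid as (Hn & _).
  destruct (HM n m d (encode n m d eps f C V) Hn) as (b & Hdec & Hb).
  { apply length_encode. }
  exists b. split; [exact Hdec|]. rewrite Hb, control_iff_good by exact Hvalid.
  rewrite eval_search by (exact Hn || (intros; lia) || lia). split.
  - intros (K & H1 & _ & H3). exists K. split; [exact H1|exact H3].
  - intros (K & H1 & H3). exists K. split; [exact H1|split; [intros; lia|exact H3]].
Qed.
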